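(* Let $\lambda$ be a partition of $n$, $\mathfrak{t}\in\mathfrak{T}_n(\lambda)$ and $k$ an integer with $1\le k<n$. Let the coefficients $e_k(\mathfrak{s},\mathfrak{u})\in F$, for $\mathfrak{s},\mathfrak{u}\in\mathfrak{T}_n(\lambda)$, be determined by $f_{\mathfrak{u}}e_k=\sum_{\mathfrak{s}\in\mathfrak{T}_n(\lambda)}e_k(\mathfrak{s},\mathfrak{u})f_{\mathfrak{s}}$. Then: (1) if $\mathfrak{s}\in\mathfrak{T}_n(\lambda)$ and $e_k(\mathfrak{s},\mathfrak{t})\ne0$, then $r_{\mathfrak{s}}(i)=r_{\mathfrak{t}}(i)$ whenever $i\ne k$ and $i\neq k+1$; (2) if $e_k(\mathfrak{s},\mathfrak{t})\ne0$ for some $\mathfrak{s}\in\mathfrak{T}_n(\lambda)$, then $\mathfrak{t}^{(k-1)}=\mathfrak{t}^{(k+1)}$ and $\mathfrak{s}^{(k-1)}=\mathfrak{s}^{(k+1)}$; (3) if $e_k(\mathfrak{s},\mathfrak{t})\ne0$ for some $\mathfrak{s}\in\mathfrak{T}_n(\lambda)$ with $\mathfrak{s}\ne\mathfrak{t}$, then $e_k(\mathfrak{u},\mathfrak{t})=0$ whenever $\mathfrak{u}\notin\{\mathfrak{s},\mathfrak{t}\}$; (4) if $e_k(\mathfrak{s},\mathfrak{t})\ne0$, where $\mathfrak{s}\in\mathfrak{T}_n(\lambda)$ and $\mathfrak{t}\rhd\mathfrak{s}$, then $$e_k(\mathfrak{t},\mathfrak{t})=\frac{r_{\mathfrak{t}}(k+1)+z_{\mathfrak{t}}(k-1)}{p_k-xz_{\mathfrak{t}}(k-1)-2r_{\mathfrak{t}}(k)},\qquad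 e_k(\mathfrak{s},\mathfrak{t})=1,$$ $$e_k(\mathfrak{s},\mathfrak{s})=\frac{r_{\mathfrak{s}}(k+1)+z_{\mathfrak{s}}(k-1)}{p_k-xz_{\mathfrak{s}}(k-1)-2r_{\mathfrak{s}}(k)},\qquad e_k(\mathfrak{t},\mathfrak{s})=e_k(\mathfrak{s},\mathfrak{s})\,e_k(\mathfrak{t},\mathfrak{t}).$$
   Context: Let $x$ be an indeterminate, $R=\mathbb{Z}[x]$ and $F$ the field of fractions of $R$. The Temperley–Lieb algebra $\mathcal{A}_n(x)$ is the unital associative $R$-algebra generated by $e_1,\dots,e_{n-1}$ subject to $e_i^2=xe_i$; $e_ie_{i\pm1}e_i=e_i$ (whenever both indices lie in $\{1,\dots,n-1\}$); $e_ie_j=e_je_i$ for $|i-j|\ge2$. By convention $\mathcal{A}_1(x)=R$, and $\mathcal{A}_i(x)$ is regarded as the subalgebra of $\mathcal{A}_{i+1}(x)$ generated by $e_1,\dots,e_{i-1}$. A partition of $n$ means a pair of integers $(i,n-2i)$ with $0\le 2i\le n$. For partitions $\lambda=(i,n-2i)$, $\mu=(j,n-2j)$ of $n$, $\lambda\unrhd\mu$ means $i\ge j$, and $\lambda\rhd\mu$ means $\lambda\unrhd\mu$ and $\lambda\ne\mu$. If $\mu$ is a partition of $n-1$ and $\lambda=(i,n-2i)$ a partition of $n$, write $\mu\to\lambda$ if $\mu=(i,n-2i-1)$ or $\mu=(i-1,n-2i+1)$. $\mathfrak{T}_n(\lambda)$ is the set of sequences $(\lambda^{(0)},\dots,\lambda^{(n)})$,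 with $\lambda^{(k)}$ a partition of $k$, such that $\lambda^{(0)}=(0,0)$, $\lambda^{(k-1)}\to\lambda^{(k)}$ for $k=1,\dots,n$, and $\lambda^{(n)}=\lambda$. For $\mathfrak{s}=(\lambda^{(0)},\dots,\lambda^{(n)})$ write $\mathrm{Shape}(\mathfrak{s})=\lambda^{(n)}$ and $\mathfrak{s}|_k=(\lambda^{(0)},\dots,\lambda^{(k)})$; if $\lambda^{(k)}=(j,k-2j)$, $\mathfrak{s}^{(k)}$ denotes the one-row Young diagram with $k-2j$ boxes. For $\mathfrak{s},\mathfrak{t}\in\mathfrak{T}_n(\lambda)$, $\mathfrak{s}\unrhd\mathfrak{t}$ means $\mathrm{Shape}(\mathfrak{s}|_k)\unrhd\mathrm{Shape}(\mathfrak{t}|_k)$ for $k=1,\dots,n$; $\mathfrak{s}\rhd\mathfrak{t}$ means in addition $\mathfrak{s}\neq\mathfrak{t}$. For $\lambda=(f,n-2f)$ let $m_\lambda=e_1e_3\cdots e_{2f-1}$ ($=1$ if $f=0$). $\mathcal{A}_n^\lambda$ is the two-sided ideal of $\mathcal{A}_n(x)$ generated by $m_\lambda$ and $\check{\mathcal{A}}_n^\lambda=\sum_{\mu\rhd\lambda}\mathcal{A}_n^\mu$. Put $w_{i,j}=e_ie_{i+1}\cdots e_{j-1}$ if $i<j$, $w_{i,j}=e_{i-1}e_{i-2}\cdots e_j$ if $j<i$, $w_{i,i}=1$. Define $v_{\mathfrak{t}}=1$ if $\mathfrak{t}=((0,0))$; if $\mathfrak{t}\in\mathfrak{T}_n(\lambda)$,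 $\lambda=(f,n-2f)$, $\mathfrak{s}=\mathfrak{t}|_{n-1}$, then $v_{\mathfrak{t}}=v_{\mathfrak{s}}$ if $\mathrm{Shape}(\mathfrak{s})=(f,n-2f-1)$ and $v_{\mathfrak{t}}=w_{2f,n}v_{\mathfrak{s}}$ if $\mathrm{Shape}(\mathfrak{s})=(f-1,n-2f+1)$. $C^\lambda$ is the right submodule of $\mathcal{A}_n(x)/\check{\mathcal{A}}_n^\lambda$ generated by $m_\lambda+\check{\mathcal{A}}_n^\lambda$, with $R$-basis $m_{\mathfrak{t}}=m_\lambda v_{\mathfrak{t}}+\check{\mathcal{A}}_n^\lambda$, $\mathfrak{t}\in\mathfrak{T}_n(\lambda)$; from here on $C^\lambda$ is extended to a module over $\mathcal{A}_n(x)\otimes_RF$. Define $T_0=T_1=0$, $T_2=e_1$ and $T_{i+1}=-e_iT_i-T_ie_i+e_ie_{i-1}T_ie_i-z_{i-1}-e_iz_{i-2}$ for $i\ge2$, where $z_0=z_1=0$ and $z_i=\sum_{k=0}^ix^kT_{i-k}$ for $i\ge2$. Define $p_0=0$, $p_1=1$, $p_{i+1}=xp_i-p_{i-1}$ for $i\ge 1$. For $\mathfrak{t}\in\mathfrak{T}_n(\lambda)$ define $r_{\mathfrak{t}}(0)=r_{\mathfrak{t}}(1)=0$ and, for $k\ge2$ with $\mathrm{Shape}(\mathfrak{t}|_k)=(i,k-2i)$: $r_{\mathfrak{t}}(k)=(p_i-xp_{i-1})p_{k-i+1}$ if $\mathrm{Shape}(\mathfrak{t}|_{k-1})=(i-1,k-2i+1)$,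 and $r_{\mathfrak{t}}(k)=(p_{k-i+1}-xp_{k-i})p_i$ if $\mathrm{Shape}(\mathfrak{t}|_{k-1})=(i,k-2i-1)$. Put $z_{\mathfrak{t}}(k)=\sum_{i=0}^kx^ir_{\mathfrak{t}}(k-i)$. Let $\mathfrak{R}(k)=\{r_{\mathfrak{t}}(k):\mathfrak{t}\in\mathfrak{T}_k(\mu),\ \mu\text{ a partition of }k\}$, and for $\mathfrak{t}\in\mathfrak{T}_n(\lambda)$ let $$F_{\mathfrak{t}}=\prod_{k=2}^n\ \prod_{r\in\mathfrak{R}(k),\,r\ne r_{\mathfrak{t}}(k)}\frac{T_k-r}{r_{\mathfrak{t}}(k)-r},\qquad f_{\mathfrak{t}}=m_{\mathfrak{t}}F_{\mathfrak{t}}.$$ The set $\{f_{\mathfrak{t}}:\mathfrak{t}\in\mathfrak{T}_n(\lambda)\}$ is an $F$-basis of $C^\lambda$. *)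

(* Defs.v *)
From HB Require Import structures.
From mathcomp Require Import all_boot all_order all_algebra.
From mathcomp Require Import generic_quotient ring_quotient fraction.
From mathcomp Require Import boolp.

Set Implicit Arguments.
Unset Strict Implicit.
Unset Printing Implicit Defensive.

Import GRing.Theory.
Local Open Scope ring_scope.
Local Open Scope quotient_scope.

(* [frac_ext M] is the tensor product of the K-module M with Frac K over K:
   the abelian group generated by the symbols m (x) s, subject to
   biadditivity and to (a *: m) (x) s = m (x) (a * s).                       *)
Section FractionExtension.

Variable K : idomainType.
Local Notation F := {fraction K}.

Section Construction.

Variable M : lmodType K.

Inductive tens_term :=
  | TensPure of M & F
  | TensZero
  | TensOpp of tens_term
  | TensAdd of tens_term & tens_term.

Inductive tens_eq : tens_term -> tens_term -> Prop :=
  | tens_refl x : tens_eq x x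
  | tens_sym x y : tens_eq x y -> tens_eq y x
  | tens_trans y x z : tens_eq x y -> tens_eq y z -> tens_eq x z
  | tens_opp x x' : tens_eq x x' -> tens_eq (TensOpp x) (TensOpp x')
  | tens_add x x' y y' :
      tens_eq x x' -> tens_eq y y' -> tens_eq (TensAdd x y) (TensAdd x' y')
  | tens_addA x y z :
      tens_eq (TensAdd x (TensAdd y z)) (TensAdd (TensAdd x y) z)
  | tens_addC x y : tens_eq (TensAdd x y) (TensAdd y x)
  | tens_add0 x : tens_eq (TensAdd TensZero x) x
  | tens_addN x : tens_eq (TensAdd (TensOpp x) x) TensZero
  | tens_Dl m m' s :
      tens_eq (TensPure (m + m') s) (TensAdd (TensPure m s) (TensPure m' s))
  | tens_Dr m s s' :
      tens_eq (TensPure m (s + s')) (TensAdd (TensPure m s) (TensPure m s'))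
  | tens_Z a m s :
      tens_eq (TensPure (a *: m) s) (TensPure m (FracField.tofrac a * s)).

HB.instance Definition _ := gen_eqMixin tens_term.
HB.instance Definition _ := gen_choiceMixin tens_term.

Definition tens_eqb x y := `[< tens_eq x y >].

Lemma tens_eqb_equiv : equiv_class_of tens_eqb.
Proof.
split.
- by move=> x; apply/asboolP; exact: tens_refl.
- by move=> x y; apply/asboolP/asboolP => h; exact: tens_sym h.
- move=> y x z /asboolP h1 /asboolP h2; apply/asboolP.
  exact: tens_trans h1 h2.
Qed.
Canonical tens_eqb_equiv_rel := EquivRelPack tens_eqb_equiv.

Definition frac_ext := {eq_quot tens_eqb}.
HB.instance Definition _ := Choice.on frac_ext.
HB.instance Definition _ := EqQuotient.on frac_ext.

Lemma tens_piP x y : \pi_frac_ext x = \pi_frac_ext y <-> tens_eq x y.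
Proof.
split=> [/eqmodP h | h].
  by move: h => /asboolP.
by apply/eqmodP; apply/asboolP.
Qed.

Lemma tens_repr x : tens_eq (repr (\pi_frac_ext x)) x.
Proof. by apply/tens_piP; rewrite reprK. Qed.

Definition frac_ext_add (x y : frac_ext) : frac_ext :=
  locked (\pi_frac_ext (TensAdd (repr x) (repr y))).
Definition frac_ext_opp (x : frac_ext) : frac_ext :=
  locked (\pi_frac_ext (TensOpp (repr x))).

Lemma frac_ext_addE x y :
  frac_ext_add (\pi_frac_ext x) (\pi_frac_ext y) = \pi_frac_ext (TensAdd x y).
Proof.
by rewrite /frac_ext_add -lock; apply/tens_piP/tens_add; exact: tens_repr.
Qed.
Lemma frac_ext_oppE x :
  frac_ext_opp (\pi_frac_ext x) = \pi_frac_ext (TensOpp x).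
Proof.
by rewrite /frac_ext_opp -lock; apply/tens_piP/tens_opp; exact: tens_repr.
Qed.

Lemma frac_ext_addA : associative frac_ext_add.
Proof.
elim/quotW=> x; elim/quotW=> y; elim/quotW=> z; rewrite !frac_ext_addE.
by apply/tens_piP; exact: tens_addA.
Qed.
Lemma frac_ext_addC : commutative frac_ext_add.
Proof.
elim/quotW=> x; elim/quotW=> y; rewrite !frac_ext_addE.
by apply/tens_piP; exact: tens_addC.
Qed.
Lemma frac_ext_add0 : left_id (\pi_frac_ext TensZero) frac_ext_add.
Proof.
elim/quotW=> x; rewrite frac_ext_addE; apply/tens_piP; exact: tens_add0.
Qed.
Lemma frac_ext_addN :
  left_inverse (\pi_frac_ext TensZero) frac_ext_opp frac_ext_add.
Proof.
elim/quotW=> x; rewrite frac_ext_oppE frac_ext_addE; apply/tens_piP.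
exact: tens_addN.
Qed.
HB.instance Definition _ := GRing.isZmodule.Build frac_ext
  frac_ext_addA frac_ext_addC frac_ext_add0 frac_ext_addN.

Definition tens (m : M) (s : F) : frac_ext := \pi_frac_ext (TensPure m s).

Lemma tensDl m m' s : tens (m + m') s = tens m s + tens m' s.
Proof. rewrite [RHS]frac_ext_addE; apply/tens_piP; exact: tens_Dl. Qed.
Lemma tensDr m s s' : tens m (s + s') = tens m s + tens m s'.
Proof. rewrite [RHS]frac_ext_addE; apply/tens_piP; exact: tens_Dr. Qed.
Lemma tensZ a m s : tens (a *: m) s = tens m (FracField.tofrac a * s).
Proof. by apply/tens_piP; exact: tens_Z. Qed.

Lemma frac_ext_ind (P : frac_ext -> Prop) :
  (forall m s, P (tens m s)) -> P 0 -> (forall x, P x -> P (- x)) ->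
  (forall x y, P x -> P y -> P (x + y)) -> forall x, P x.
Proof.
move=> Pp P0 PN PD; elim/quotW; elim=> [m s||x Px|x Px y Py] //.
- exact: Pp.
- by rewrite -frac_ext_oppE; exact: PN.
- by rewrite -frac_ext_addE; exact: PD.
Qed.

(* The universal property: [tens_lift g] is meaningful when g is balanced.   *)
Record balanced (V : zmodType) (g : M -> F -> V) : Prop := Balanced {
  balancedDl : forall m m' s, g (m + m') s = g m s + g m' s;
  balancedDr : forall m s s', g m (s + s') = g m s + g m s';
  balancedZ : forall a m s, g (a *: m) s = g m (FracField.tofrac a * s)
}.

Fixpoint tens_eval (V : zmodType) (g : M -> F -> V) (x : tens_term) : V :=
  match x with
  | TensPure m s => g m s
  | TensZero => 0
  | TensOpp y => - tens_eval g y
  | TensAdd y z => tens_eval g y + tens_eval g z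
  end.

Definition tens_lift (V : zmodType) (g : M -> F -> V) (x : frac_ext) : V :=
  tens_eval g (repr x).

Section Lift.
Variables (V : zmodType) (g : M -> F -> V).
Hypothesis gB : balanced g.

Lemma tens_eval_eq x y : tens_eq x y -> tens_eval g x = tens_eval g y.
Proof.
elim=> //= [y' x' z _ -> _ -> | x' y' _ -> | x' y' z w _ -> _ -> | *
  | * | * | * | * | * | *] //.
- exact: addrA.
- exact: addrC.
- exact: add0r.
- exact: addNr.
- exact: balancedDl.
- exact: balancedDr.
- exact: balancedZ.
Qed.

Lemma tens_lift_pi x : tens_lift g (\pi_frac_ext x) = tens_eval g x.
Proof. by apply: tens_eval_eq; exact: tens_repr. Qed.
Lemma tens_liftE m s : tens_lift g (tens m s) = g m s.
Proof. exact: tens_lift_pi. Qed.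
Lemma tens_lift0 : tens_lift g 0 = 0.
Proof. exact: tens_lift_pi. Qed.
Lemma tens_liftD x y : tens_lift g (x + y) = tens_lift g x + tens_lift g y.
Proof.
elim/quotW: x => x; elim/quotW: y => y.
by rewrite [_ + _]frac_ext_addE !tens_lift_pi.
Qed.
Lemma tens_liftN x : tens_lift g (- x) = - tens_lift g x.
Proof. by elim/quotW: x => x; rewrite [- _]frac_ext_oppE !tens_lift_pi. Qed.
End Lift.

Definition frac_ext_scale (c : F) : frac_ext -> frac_ext :=
  tens_lift (fun m s => tens m (c * s)).

Lemma scale_balanced c : balanced (fun m s => tens m (c * s)).
Proof.
split=> *; first exact: tensDl.
  by rewrite mulrDr tensDr.
by rewrite tensZ mulrCA.
Qed.

Lemma frac_ext_scaleA c d x :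
  frac_ext_scale c (frac_ext_scale d x) = frac_ext_scale (c * d) x.
Proof.
have B := scale_balanced; rewrite /frac_ext_scale.
elim/frac_ext_ind: x => [m s||x Px|x y Px Py].
- by rewrite !(tens_liftE (B _)) mulrA.
- by rewrite !(tens_lift0 (B _)).
- by rewrite !(tens_liftN (B _)) Px.
- by rewrite !(tens_liftD (B _)) Px Py.
Qed.
Lemma frac_ext_scale1 : left_id 1 frac_ext_scale.
Proof.
move=> x; have B := scale_balanced; rewrite /frac_ext_scale.
elim/frac_ext_ind: x => [m s||x Px|x y Px Py].
- by rewrite !(tens_liftE (B _)) mul1r.
- by rewrite !(tens_lift0 (B _)).
- by rewrite !(tens_liftN (B _)) Px.
- by rewrite !(tens_liftD (B _)) Px Py.
Qed.
Lemma frac_ext_scaleDr : right_distributive frac_ext_scale +%R.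
Proof. by move=> c x y; exact: tens_liftD (scale_balanced c) _ _. Qed.
Lemma frac_ext_scaleDl x : {morph frac_ext_scale^~ x : c d / c + d}.
Proof.
move=> c d /=; have B := scale_balanced; rewrite /frac_ext_scale.
elim/frac_ext_ind: x => [m s||x Px|x y Px Py].
- by rewrite !(tens_liftE (B _)) mulrDl tensDr.
- by rewrite !(tens_lift0 (B _)) addr0.
- by rewrite !(tens_liftN (B _)) Px opprD.
- by rewrite !(tens_liftD (B _)) Px Py addrACA.
Qed.
HB.instance Definition _ := GRing.Zmodule_isLmodule.Build F frac_ext
  frac_ext_scaleA frac_ext_scale1 frac_ext_scaleDr frac_ext_scaleDl.

Lemma frac_ext_scaleE (c : F) m s : c *: tens m s = tens m (c * s).
Proof. exact: (tens_liftE (scale_balanced c)). Qed.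

End Construction.

(* The extension of a K-bilinear map b:
   (m (x) s, n (x) s') |-> b m n (x) (s * s').                               *)
Record bilinear_map (M N P : lmodType K) (b : M -> N -> P) : Prop :=
  BilinearMap {
    bilinDl : forall m m' n, b (m + m') n = b m n + b m' n;
    bilinDr : forall m n n', b m (n + n') = b m n + b m n';
    bilinZl : forall a m n, b (a *: m) n = a *: b m n;
    bilinZr : forall a m n, b m (a *: n) = a *: b m n
  }.

Definition tens_bilin (M N P : lmodType K) (b : M -> N -> P)
    (x : frac_ext M) (y : frac_ext N) : frac_ext P :=
  tens_lift (fun m s => tens_lift (fun n s' => tens (b m n) (s * s')) y) x.

Section Bilinear.
Variables (M N P : lmodType K) (b : M -> N -> P).
Hypothesis bB : bilinear_map b.

Lemma bilin_balanced1 m s : balanced (fun n s' => tens (b m n) (s * s')).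
Proof.
split=> *; first by rewrite (bilinDr bB) tensDl.
  by rewrite mulrDr tensDr.
by rewrite (bilinZr bB) tensZ mulrCA.
Qed.
Let B1 := bilin_balanced1.

Lemma bilin_balanced2 y :
  balanced (fun m s => tens_lift (fun n s' => tens (b m n) (s * s')) y).
Proof.
split=> [m m' s|m s s'|a m s]; elim/frac_ext_ind: y => [n u||y Py|y z Py Pz].
- by rewrite !(tens_liftE (B1 _ _)) (bilinDl bB) tensDl.
- by rewrite !(tens_lift0 (B1 _ _)) addr0.
- by rewrite !(tens_liftN (B1 _ _)) Py opprD.
- by rewrite !(tens_liftD (B1 _ _)) Py Pz addrACA.
- by rewrite !(tens_liftE (B1 _ _)) mulrDl tensDr.
- by rewrite !(tens_lift0 (B1 _ _)) addr0.
- by rewrite !(tens_liftN (B1 _ _)) Py opprD.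
- by rewrite !(tens_liftD (B1 _ _)) Py Pz addrACA.
- by rewrite !(tens_liftE (B1 _ _)) (bilinZl bB) tensZ mulrA.
- by rewrite !(tens_lift0 (B1 _ _)).
- by rewrite !(tens_liftN (B1 _ _)) Py.
- by rewrite !(tens_liftD (B1 _ _)) Py Pz.
Qed.
Let B2 := bilin_balanced2.

Lemma tens_bilinE m s n s' :
  tens_bilin b (tens m s) (tens n s') = tens (b m n) (s * s').
Proof. by rewrite /tens_bilin (tens_liftE (B2 _)) (tens_liftE (B1 _ _)). Qed.
Lemma tens_bilinDl x x' y :
  tens_bilin b (x + x') y = tens_bilin b x y + tens_bilin b x' y.
Proof. exact: (tens_liftD (B2 _)). Qed.
Lemma tens_bilin0l y : tens_bilin b 0 y = 0.
Proof. exact: (tens_lift0 (B2 _)). Qed.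
Lemma tens_bilinNl x y : tens_bilin b (- x) y = - tens_bilin b x y.
Proof. exact: (tens_liftN (B2 _)). Qed.
Lemma tens_bilinDr x y y' :
  tens_bilin b x (y + y') = tens_bilin b x y + tens_bilin b x y'.
Proof.
elim/frac_ext_ind: x => [m s||x Px|x z Px Pz].
- by rewrite /tens_bilin !(tens_liftE (B2 _)) (tens_liftD (B1 _ _)).
- by rewrite !tens_bilin0l addr0.
- by rewrite !tens_bilinNl Px opprD.
- by rewrite !tens_bilinDl Px Pz addrACA.
Qed.
Lemma tens_bilin0r x : tens_bilin b x 0 = 0.
Proof.
by apply: (@addrI _ (tens_bilin b x 0)); rewrite -tens_bilinDr !addr0.
Qed.
Lemma tens_bilinNr x y : tens_bilin b x (- y) = - tens_bilin b x y.
Proof.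
apply: (@addrI _ (tens_bilin b x y)).
by rewrite -tens_bilinDr !subrr tens_bilin0r.
Qed.
Lemma tens_bilinZl c x y : tens_bilin b (c *: x) y = c *: tens_bilin b x y.
Proof.
elim/frac_ext_ind: x => [m s||x Px|x z Px Pz].
- elim/frac_ext_ind: y => [n u||y Py|y z Py Pz].
  + by rewrite frac_ext_scaleE !tens_bilinE frac_ext_scaleE mulrA.
  + by rewrite !tens_bilin0r scaler0.
  + by rewrite !tens_bilinNr Py scalerN.
  + by rewrite !tens_bilinDr Py Pz scalerDr.
- by rewrite scaler0 !tens_bilin0l scaler0.
- by rewrite scalerN !tens_bilinNl scalerN Px.
- by rewrite scalerDr !tens_bilinDl scalerDr Px Pz.
Qed.
Lemma tens_bilinZr c x y : tens_bilin b x (c *: y) = c *: tens_bilin b x y.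
Proof.
elim/frac_ext_ind: x => [m s||x Px|x z Px Pz].
- elim/frac_ext_ind: y => [n u||y Py|y z Py Pz].
  + by rewrite frac_ext_scaleE !tens_bilinE frac_ext_scaleE mulrCA.
  + by rewrite scaler0 !tens_bilin0r scaler0.
  + by rewrite scalerN !tens_bilinNr Py scalerN.
  + by rewrite scalerDr !tens_bilinDr Py Pz scalerDr.
- by rewrite !tens_bilin0l scaler0.
- by rewrite !tens_bilinNl scalerN Px.
- by rewrite !tens_bilinDl scalerDr Px Pz.
Qed.
End Bilinear.

End FractionExtension.

Notation Zx := {poly int}.
Notation Zx_frac := {fraction {poly int}}.
Notation "a %:F" := (FracField.tofrac (a : Zx)) : ring_scope.

Section TemperleyLieb.

Variable n : nat.

Definition tl_index := {i : nat | 0 < i < n}%N.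

Inductive tl_term :=
  | TLConst of Zx
  | TLGen of tl_index
  | TLOpp of tl_term
  | TLAdd of tl_term & tl_term
  | TLMul of tl_term & tl_term.

(* The congruence generated by the axioms of unital associative Z[x]-algebras
   and the Temperley-Lieb relations.                                         *)
Inductive tl_eq : tl_term -> tl_term -> Prop :=
  | tl_refl a : tl_eq a a
  | tl_sym a b : tl_eq a b -> tl_eq b a
  | tl_trans b a c : tl_eq a b -> tl_eq b c -> tl_eq a c
  | tl_opp a a' : tl_eq a a' -> tl_eq (TLOpp a) (TLOpp a')
  | tl_add a a' b b' :
      tl_eq a a' -> tl_eq b b' -> tl_eq (TLAdd a b) (TLAdd a' b')
  | tl_mul a a' b b' :
      tl_eq a a' -> tl_eq b b' -> tl_eq (TLMul a b) (TLMul a' b')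
  | tl_addA a b c : tl_eq (TLAdd a (TLAdd b c)) (TLAdd (TLAdd a b) c)
  | tl_addC a b : tl_eq (TLAdd a b) (TLAdd b a)
  | tl_add0 a : tl_eq (TLAdd (TLConst 0) a) a
  | tl_addN a : tl_eq (TLAdd (TLOpp a) a) (TLConst 0)
  | tl_mulA a b c : tl_eq (TLMul a (TLMul b c)) (TLMul (TLMul a b) c)
  | tl_mul1l a : tl_eq (TLMul (TLConst 1) a) a
  | tl_mul1r a : tl_eq (TLMul a (TLConst 1)) a
  | tl_mulDl a b c : tl_eq (TLMul (TLAdd a b) c) (TLAdd (TLMul a c) (TLMul b c))
  | tl_mulDr a b c : tl_eq (TLMul a (TLAdd b c)) (TLAdd (TLMul a b) (TLMul a c))
  | tl_constD r s : tl_eq (TLConst (r + s)) (TLAdd (TLConst r) (TLConst s))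
  | tl_constM r s : tl_eq (TLConst (r * s)) (TLMul (TLConst r) (TLConst s))
  | tl_constC r a : tl_eq (TLMul (TLConst r) a) (TLMul a (TLConst r))
  | tl_sqr i :
      tl_eq (TLMul (TLGen i) (TLGen i)) (TLMul (TLConst 'X) (TLGen i))
  | tl_braid (i j : tl_index) :
      (val j == (val i).+1) || (val i == (val j).+1) ->
      tl_eq (TLMul (TLMul (TLGen i) (TLGen j)) (TLGen i)) (TLGen i)
  | tl_comm (i j : tl_index) :
      ((val i).+2 <= val j)%N || ((val j).+2 <= val i)%N ->
      tl_eq (TLMul (TLGen i) (TLGen j)) (TLMul (TLGen j) (TLGen i)).

HB.instance Definition _ := gen_eqMixin tl_term.
HB.instance Definition _ := gen_choiceMixin tl_term.

Definition tl_eqb a b := `[< tl_eq a b >].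

Lemma tl_eqb_equiv : equiv_class_of tl_eqb.
Proof.
split.
- by move=> x; apply/asboolP; exact: tl_refl.
- by move=> x y; apply/asboolP/asboolP => h; exact: tl_sym h.
- by move=> y x z /asboolP h1 /asboolP h2; apply/asboolP; exact: tl_trans h1 h2.
Qed.
Canonical tl_eqb_equiv_rel := EquivRelPack tl_eqb_equiv.

Definition TL := {eq_quot tl_eqb}.
HB.instance Definition _ := Choice.on TL.
HB.instance Definition _ := EqQuotient.on TL.

Lemma tl_piP a b : \pi_TL a = \pi_TL b <-> tl_eq a b.
Proof.
split=> [/eqmodP h | h].
  by move: h => /asboolP.
by apply/eqmodP; apply/asboolP.
Qed.

Lemma tl_repr a : tl_eq (repr (\pi_TL a)) a.
Proof. by apply/tl_piP; rewrite reprK. Qed.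

Definition tlq_opp (a : TL) : TL :=
  locked (\pi_TL (TLOpp (repr a))).
Definition tlq_add (a b : TL) : TL :=
  locked (\pi_TL (TLAdd (repr a) (repr b))).
Definition tlq_mul (a b : TL) : TL :=
  locked (\pi_TL (TLMul (repr a) (repr b))).
Definition tlq_scale (r : Zx) (a : TL) : TL :=
  locked (\pi_TL (TLMul (TLConst r) (repr a))).

Lemma tlq_oppE a : tlq_opp (\pi_TL a) = \pi_TL (TLOpp a).
Proof.
by rewrite /tlq_opp -lock; apply/tl_piP/tl_opp; exact: tl_repr.
Qed.
Lemma tlq_addE a b : tlq_add (\pi_TL a) (\pi_TL b) = \pi_TL (TLAdd a b).
Proof.
by rewrite /tlq_add -lock; apply/tl_piP/tl_add; exact: tl_repr.
Qed.
Lemma tlq_mulE a b : tlq_mul (\pi_TL a) (\pi_TL b) = \pi_TL (TLMul a b).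
Proof.
by rewrite /tlq_mul -lock; apply/tl_piP/tl_mul; exact: tl_repr.
Qed.
Lemma tlq_scaleE r a : tlq_scale r (\pi_TL a) = \pi_TL (TLMul (TLConst r) a).
Proof.
rewrite /tlq_scale -lock; apply/tl_piP/tl_mul; [exact: tl_refl | exact: tl_repr].
Qed.

Lemma tlq_addA : associative tlq_add.
Proof.
elim/quotW=> a; elim/quotW=> b; elim/quotW=> c; rewrite !tlq_addE.
by apply/tl_piP; exact: tl_addA.
Qed.
Lemma tlq_addC : commutative tlq_add.
Proof.
elim/quotW=> a; elim/quotW=> b; rewrite !tlq_addE.
by apply/tl_piP; exact: tl_addC.
Qed.
Lemma tlq_add0 : left_id (\pi_TL (TLConst 0)) tlq_add.
Proof. by elim/quotW=> a; rewrite tlq_addE; apply/tl_piP; exact: tl_add0. Qed.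
Lemma tlq_addN : left_inverse (\pi_TL (TLConst 0)) tlq_opp tlq_add.
Proof.
elim/quotW=> a; rewrite tlq_oppE tlq_addE; apply/tl_piP; exact: tl_addN.
Qed.
HB.instance Definition _ := GRing.isZmodule.Build TL
  tlq_addA tlq_addC tlq_add0 tlq_addN.

Lemma tlq_mulA : associative tlq_mul.
Proof.
elim/quotW=> a; elim/quotW=> b; elim/quotW=> c; rewrite !tlq_mulE.
by apply/tl_piP; exact: tl_mulA.
Qed.
Lemma tlq_mul1l : left_id (\pi_TL (TLConst 1)) tlq_mul.
Proof. by elim/quotW=> a; rewrite tlq_mulE; apply/tl_piP; exact: tl_mul1l. Qed.
Lemma tlq_mul1r : right_id (\pi_TL (TLConst 1)) tlq_mul.
Proof. by elim/quotW=> a; rewrite tlq_mulE; apply/tl_piP; exact: tl_mul1r. Qed.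
Lemma tlq_mulDl : left_distributive tlq_mul tlq_add.
Proof.
elim/quotW=> a; elim/quotW=> b; elim/quotW=> c.
rewrite tlq_addE !tlq_mulE tlq_addE; apply/tl_piP; exact: tl_mulDl.
Qed.
Lemma tlq_mulDr : right_distributive tlq_mul tlq_add.
Proof.
elim/quotW=> a; elim/quotW=> b; elim/quotW=> c.
rewrite tlq_addE !tlq_mulE tlq_addE; apply/tl_piP; exact: tl_mulDr.
Qed.

(* The character killing every generator; it shows that the algebra is not
   trivial.                                                                  *)
Fixpoint tl_aug (a : tl_term) : Zx :=
  match a with
  | TLConst r => r
  | TLGen _ => 0
  | TLOpp b => - tl_aug b
  | TLAdd b c => tl_aug b + tl_aug c
  | TLMul b c => tl_aug b * tl_aug c
  end.

Lemma tl_aug_eq a b : tl_eq a b -> tl_aug a = tl_aug b.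
Proof.
elim=> //= [b' a' c _ -> _ -> | ? ? _ -> | ? ? ? ? _ -> _ -> | ? ? ? ? _ -> _ ->
  | * | * | * | * | * | * | * | * | * | * | * | *] //.
- exact: addrA.
- exact: addrC.
- exact: add0r.
- exact: addNr.
- exact: mulrA.
- exact: mul1r.
- exact: mulr1.
- exact: mulrDl.
- exact: mulrDr.
- exact: mulrC.
- by rewrite !mulr0.
- by rewrite mulr0.
Qed.

Lemma tlq_neq0 : \pi_TL (TLConst 1) != \pi_TL (TLConst 0) :> TL.
Proof. by apply/eqP=> /tl_piP /tl_aug_eq /eqP; rewrite /= oner_eq0. Qed.

HB.instance Definition _ := GRing.Zmodule_isNzRing.Build TL
  tlq_mulA tlq_mul1l tlq_mul1r tlq_mulDl tlq_mulDr tlq_neq0.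

Lemma tlq_scaleA r s a : tlq_scale r (tlq_scale s a) = tlq_scale (r * s) a.
Proof.
elim/quotW: a => a; rewrite !tlq_scaleE; apply/tl_piP.
apply: tl_trans (tl_mulA _ _ _) _; apply: tl_mul (tl_refl _).
exact: tl_sym (tl_constM _ _).
Qed.
Lemma tlq_scale1 : left_id 1 tlq_scale.
Proof. by elim/quotW=> a; rewrite tlq_scaleE; apply/tl_piP; exact: tl_mul1l. Qed.
Lemma tlq_scaleDr : right_distributive tlq_scale +%R.
Proof.
move=> r; elim/quotW=> a; elim/quotW=> b.
rewrite [in LHS]/GRing.add /= tlq_addE !tlq_scaleE [RHS]tlq_addE.
by apply/tl_piP; exact: tl_mulDr.
Qed.
Lemma tlq_scaleDl a : {morph tlq_scale^~ a : r s / r + s}.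
Proof.
move=> r s /=; elim/quotW: a => a; rewrite !tlq_scaleE [RHS]tlq_addE.
apply/tl_piP; apply: tl_trans (tl_mulDl _ _ _).
exact: tl_mul (tl_constD _ _) (tl_refl _).
Qed.
HB.instance Definition _ := GRing.Zmodule_isLmodule.Build Zx TL
  tlq_scaleA tlq_scale1 tlq_scaleDr tlq_scaleDl.

Lemma tlq_scaleAl (r : Zx) (a b : TL) : r *: (a * b) = (r *: a) * b.
Proof.
elim/quotW: a => a; elim/quotW: b => b.
rewrite [X in _ *: X]tlq_mulE [LHS]tlq_scaleE.
rewrite [X in _ = X * _]tlq_scaleE [RHS]tlq_mulE.
by apply/tl_piP; exact: tl_mulA.
Qed.
HB.instance Definition _ := GRing.Lmodule_isLalgebra.Build Zx TL tlq_scaleAl.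

Lemma tlq_scaleAr (r : Zx) (a b : TL) : r *: (a * b) = a * (r *: b).
Proof.
elim/quotW: a => a; elim/quotW: b => b.
rewrite [X in _ *: X]tlq_mulE [LHS]tlq_scaleE.
rewrite [X in _ = _ * X]tlq_scaleE [RHS]tlq_mulE.
apply/tl_piP; apply: tl_trans (tl_mulA _ _ _) _.
apply: tl_trans (tl_sym (tl_mulA _ _ _)).
exact: tl_mul (tl_constC _ _) (tl_refl _).
Qed.
HB.instance Definition _ := GRing.Lalgebra_isAlgebra.Build Zx TL tlq_scaleAr.

(* e_i for 0 < i < n; the value at the other indices is junk.                *)
Definition tl_e (i : nat) : TL :=
  if insub i is Some j then \pi_TL (TLGen j) else 0.

End TemperleyLieb.

Lemma tl_mul_bilinear n : bilinear_map (fun a b : TL n => a * b).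
Proof.
split=> *; [exact: mulrDl | exact: mulrDr | by rewrite scalerAl |].
by rewrite scalerAr.
Qed.

Definition TLF (n : nat) := frac_ext (TL n).
HB.instance Definition _ n := GRing.Lmodule.on (TLF n).

Section TemperleyLiebF.

Variable n : nat.

Definition tlf_mul : TLF n -> TLF n -> TLF n :=
  tens_bilin (fun a b : TL n => a * b).
Let B := tl_mul_bilinear n.

Lemma tlf_mulA : associative tlf_mul.
Proof.
rewrite /tlf_mul => x y z; elim/frac_ext_ind: x => [a r||x Px|x x' Px Px'].
- elim/frac_ext_ind: y => [b s||y Py|y y' Py Py'].
  + elim/frac_ext_ind: z => [c t||z Pz|z z' Pz Pz'].
    * by rewrite !(tens_bilinE B) !mulrA.
    * by rewrite !(tens_bilin0r B).
    * by rewrite !(tens_bilinNr B) Pz.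
    * by rewrite !(tens_bilinDr B) Pz Pz'.
  + by rewrite !(tens_bilin0r B, tens_bilin0l B).
  + by rewrite !(tens_bilinNr B, tens_bilinNl B) Py.
  + by rewrite !(tens_bilinDr B, tens_bilinDl B) Py Py'.
- by rewrite !(tens_bilin0l B).
- by rewrite !(tens_bilinNl B) Px.
- by rewrite !(tens_bilinDl B) Px Px'.
Qed.
Lemma tlf_mul1l : left_id (tens 1 1) tlf_mul.
Proof.
rewrite /tlf_mul => x; elim/frac_ext_ind: x => [a r||x Px|x x' Px Px'].
- by rewrite (tens_bilinE B) !mul1r.
- by rewrite (tens_bilin0r B).
- by rewrite (tens_bilinNr B) Px.
- by rewrite (tens_bilinDr B) Px Px'.
Qed.
Lemma tlf_mul1r : right_id (tens 1 1) tlf_mul.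
Proof.
rewrite /tlf_mul => x; elim/frac_ext_ind: x => [a r||x Px|x x' Px Px'].
- by rewrite (tens_bilinE B) !mulr1.
- by rewrite (tens_bilin0l B).
- by rewrite (tens_bilinNl B) Px.
- by rewrite (tens_bilinDl B) Px Px'.
Qed.
Lemma tlf_mulDl : left_distributive tlf_mul +%R.
Proof. by move=> x y z; exact: (tens_bilinDl B). Qed.
Lemma tlf_mulDr : right_distributive tlf_mul +%R.
Proof. by move=> x y z; exact: (tens_bilinDr B). Qed.

Definition tlf_aug : TLF n -> Zx_frac :=
  tens_lift (fun (a : TL n) s => (tl_aug (repr a))%:F * s).

Lemma tl_aug_repr a : tl_aug (repr (\pi_(TL n) a)) = tl_aug a.
Proof. by apply: tl_aug_eq; exact: tl_repr. Qed.

Lemma tlf_aug_balanced :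
  balanced (fun (a : TL n) (s : Zx_frac) => (tl_aug (repr a))%:F * s).
Proof.
split=> [a b s|a s s'|r a s]; last 2 first.
- by rewrite mulrDr.
- elim/quotW: a => a; rewrite [_ *: _]tlq_scaleE !tl_aug_repr /= tofracM.
  by rewrite -mulrA mulrCA.
elim/quotW: a => a; elim/quotW: b => b; rewrite [_ + _ in LHS]tlq_addE.
by rewrite !tl_aug_repr /= tofracD mulrDl.
Qed.

Lemma tlf_neq0 : tens 1 1 != 0 :> TLF n.
Proof.
apply/eqP=> /(congr1 tlf_aug); rewrite /tlf_aug (tens_liftE tlf_aug_balanced).
rewrite (tens_lift0 tlf_aug_balanced) mulr1 tl_aug_repr /= tofrac1.
by apply/eqP; rewrite oner_eq0.
Qed.

HB.instance Definition _ := GRing.Zmodule_isNzRing.Build (TLF n)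
  tlf_mulA tlf_mul1l tlf_mul1r tlf_mulDl tlf_mulDr tlf_neq0.

Lemma tlf_scaleAl (c : Zx_frac) (a b : TLF n) : c *: (a * b) = (c *: a) * b.
Proof. exact: esym (tens_bilinZl B _ _ _). Qed.
HB.instance Definition _ := GRing.Lmodule_isLalgebra.Build Zx_frac (TLF n)
  tlf_scaleAl.
Lemma tlf_scaleAr (c : Zx_frac) (a b : TLF n) : c *: (a * b) = a * (c *: b).
Proof. exact: esym (tens_bilinZr B _ _ _). Qed.
HB.instance Definition _ := GRing.Lalgebra_isAlgebra.Build Zx_frac (TLF n)
  tlf_scaleAr.

Definition tlF (a : TL n) : TLF n := tens a 1.

End TemperleyLiebF.

Definition is_part (n : nat) (la : nat * nat) : bool :=
  (la.1.*2 + la.2 == n)%N.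

Definition parts (n : nat) : seq (nat * nat) :=
  [seq (i, (n - i.*2)%N) | i <- iota 0 n./2.+1].

Lemma mem_parts n la : (la \in parts n) = is_part n la.
Proof.
apply/mapP/idP => [[i] | /eqP <-].
  rewrite mem_iota add0n ltnS /= => hi ->; rewrite /is_part /= subnKC //.
  by rewrite -geq_half_double.
exists la.1; last by rewrite addKn; case: la.
by rewrite mem_iota add0n ltnS /= geq_half_double leq_addr.
Qed.

Definition part_dom (la mu : nat * nat) : bool := (mu.1 <= la.1)%N.
Definition part_sdom (la mu : nat * nat) : bool := part_dom la mu && (la != mu).

(* mu -> la, for mu a partition of n - 1 and la a partition of n             *)
Definition arrow (mu la : nat * nat) : bool :=
  (la == (mu.1, mu.2.+1)) || ((la.1, la.2.+1) == (mu.1.+1, mu.2)).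

(* A sequence of partitions; [shape s k] is its member number k, counted
   from 0, that is the shape of its truncation (s_0, ..., s_k).              *)
Definition shape (s : seq (nat * nat)) (k : nat) : nat * nat :=
  nth (0%N, 0%N) s k.

(* The row length of the one-row Young diagram s^(k).                        *)
Definition yd_row (s : seq (nat * nat)) (k : nat) : nat := (shape s k).2.

Definition is_tab (n : nat) (la : nat * nat) (s : seq (nat * nat)) : bool :=
  [&& size s == n.+1,
      [forall k : 'I_n.+1, is_part k (shape s k)],
      shape s 0 == (0%N, 0%N),
      [forall k : 'I_n, arrow (shape s k) (shape s k.+1)]
    & shape s n == la].

(* The two entries of a partition of k <= n are at most n, so that the set of
   tableaux is a subset of a finite type.                                    *)
Definition tab_seq (n : nat) (s : seq ('I_n.+1 * 'I_n.+1)) : seq (nat * nat) :=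
  [seq (nat_of_ord p.1, nat_of_ord p.2) | p <- s].

Record tab (n : nat) (la : nat * nat) := Tab {
  tab_tuple : n.+1.-tuple ('I_n.+1 * 'I_n.+1);
  _ : is_tab n la (tab_seq tab_tuple)
}.
HB.instance Definition _ n la := [isSub for @tab_tuple n la].
HB.instance Definition _ n la := [Finite of tab n la by <:].

Definition tab_val n la (t : tab n la) : seq (nat * nat) :=
  tab_seq (tab_tuple t).
Coercion tab_val : tab >-> seq.

Lemma tab_valP n la (t : tab n la) : is_tab n la t.
Proof. by case: t. Qed.

Lemma tab_val_inj n la : injective (@tab_val n la).
Proof.
move=> s t h; apply/val_inj/val_inj; apply: inj_map h => -[a b] [c d] /= [].
by move=> /val_inj -> /val_inj ->.
Qed.

Lemma tab_surj n la s : is_tab n la s -> exists t : tab n la, tab_val t = s.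
Proof.
move=> hs; case/and5P: (hs) => /eqP sz /forallP hp _ _ _.
pose u := [seq (inord p.1 : 'I_n.+1, inord p.2 : 'I_n.+1) | p <- s].
have us : size u == n.+1 by rewrite size_map sz.
have uE : tab_seq (Tuple us) = s.
  rewrite /tab_seq /= -map_comp -[RHS]map_id; apply/eq_in_map => p ps /=.
  have ip := ps; rewrite -index_mem sz in ip.
  have := hp (Ordinal ip); rewrite /= /shape nth_index // => /eqP hk.
  rewrite !inordK; first by case: (p).
    apply: leq_ltn_trans ip; rewrite -hk leq_addl //.
  by apply: leq_ltn_trans ip; rewrite -hk -addnn -addnA leq_addr.
have ut : is_tab n la (tab_seq (Tuple us)) by rewrite uE.
by exists (Tab ut).
Qed.

Definition tab_dom n la (s t : tab n la) : bool :=
  [forall k : 'I_n.+1, (0 < k)%N ==> part_dom (shape s k) (shape t k)].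
Definition tab_sdom n la (s t : tab n la) : bool := tab_dom s t && (s != t).

Definition m_elt (n : nat) (la : nat * nat) : TL n :=
  \prod_(0 <= i < la.1) tl_e n i.*2.+1.

Definition w_elt (n i j : nat) : TL n :=
  if (i < j)%N then \prod_(i <= l < j) tl_e n l
  else if (j < i)%N then \prod_(l <- rev (index_iota j i)) tl_e n l
  else 1.

(* [v_elt n s k] is the element v of the truncation (s_0, ..., s_k).         *)
Fixpoint v_elt (n : nat) (s : seq (nat * nat)) (k : nat) : TL n :=
  if k is k'.+1 then
    if (shape s k').1 == (shape s k).1 then v_elt n s k'
    else w_elt n (shape s k).1.*2 k * v_elt n s k'
  else 1.

Definition in_ideal (n : nat) (m a : TL n) : Prop :=
  exists u : seq (TL n * TL n), a = \sum_(p <- u) p.1 * m * p.2.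

Definition check_ideal (n : nat) (la : nat * nat) : {pred TL n} :=
  fun a => `[< exists g : nat * nat -> TL n,
    (forall mu, in_ideal (m_elt n mu) (g mu)) /\
    a = \sum_(mu <- parts n | part_sdom mu la) g mu >].
Arguments check_ideal : clear implicits.

Section CellModule.

Variables (n : nat) (la : nat * nat).

Lemma in_ideal0 (m : TL n) : in_ideal m 0.
Proof. by exists [::]; rewrite big_nil. Qed.
Lemma in_idealD (m a b : TL n) :
  in_ideal m a -> in_ideal m b -> in_ideal m (a + b).
Proof. by move=> [u ->] [v ->]; exists (u ++ v); rewrite big_cat. Qed.
Lemma in_idealMl (m c a : TL n) : in_ideal m a -> in_ideal m (c * a).
Proof.
move=> [u ->]; exists [seq (c * p.1, p.2) | p <- u].
by rewrite mulr_sumr big_map; apply: eq_bigr => p _; rewrite /= !mulrA.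
Qed.
Lemma in_idealMr (m c a : TL n) : in_ideal m a -> in_ideal m (a * c).
Proof.
move=> [u ->]; exists [seq (p.1, p.2 * c) | p <- u].
by rewrite mulr_suml big_map; apply: eq_bigr => p _; rewrite /= !mulrA.
Qed.

Lemma check_idealMr (c a : TL n) :
  a \in check_ideal n la -> a * c \in check_ideal n la.
Proof.
move=> /asboolP [g [gI ->]]; apply/asboolP; exists (fun mu => g mu * c).
by split=> [mu|]; [exact: in_idealMr | rewrite mulr_suml].
Qed.

Lemma check_ideal_submod : submod_closed (check_ideal n la).
Proof.
split=> [|r a b /asboolP [g [gI ->]] /asboolP [h [hI ->]]]; apply/asboolP.
  by exists (fun=> 0); split=> [mu|]; [exact: in_ideal0 | rewrite big1].
exists (fun mu => r *: g mu + h mu); split=> [mu|].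
  apply: in_idealD (hI mu); rewrite -mulr_algl.
  exact: in_idealMl.
by rewrite scaler_sumr big_split.
Qed.
HB.instance Definition _ :=
  GRing.isSubmodClosed.Build Zx (TL n) (check_ideal n la) check_ideal_submod.

Definition tl_quot := Quotient.quot (check_ideal n la).
HB.instance Definition _ := GRing.Zmodule.on tl_quot.

Definition tlq (a : TL n) : tl_quot := \pi_(Quotient.quot (check_ideal n la)) a.

Lemma tlq_eq a b : tlq a = tlq b <-> a - b \in check_ideal n la.
Proof.
rewrite -[_ \in _]/(Quotient.equiv (check_ideal n la) a b).
by split=> [/eqquotP|] // h; apply/eqquotP.
Qed.

Lemma tlq_ind (P : tl_quot -> Prop) : (forall a, P (tlq a)) -> forall q, P q.
Proof. by move=> h; elim/quotW. Qed.

Lemma tlqD a b : tlq (a + b) = tlq a + tlq b.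
Proof. exact: raddfD. Qed.

Definition tl_quot_scale (r : Zx) (q : tl_quot) : tl_quot := tlq (r *: repr q).
Definition tl_quot_act (q : tl_quot) (c : TL n) : tl_quot := tlq (repr q * c).

Lemma tl_quot_scaleE r a : tl_quot_scale r (tlq a) = tlq (r *: a).
Proof.
apply/tlq_eq; rewrite -scalerBr; apply: rpredZ; apply/tlq_eq.
exact: reprK.
Qed.
Lemma tl_quot_actE a c : tl_quot_act (tlq a) c = tlq (a * c).
Proof.
apply/tlq_eq; rewrite -mulrBl; apply: check_idealMr; apply/tlq_eq.
exact: reprK.
Qed.

Lemma tl_quot_scaleA r s q :
  tl_quot_scale r (tl_quot_scale s q) = tl_quot_scale (r * s) q.
Proof. by elim/tlq_ind: q => a; rewrite !tl_quot_scaleE scalerA. Qed.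
Lemma tl_quot_scale1 : left_id 1 tl_quot_scale.
Proof. by elim/tlq_ind=> a; rewrite tl_quot_scaleE scale1r. Qed.
Lemma tl_quot_scaleDr : right_distributive tl_quot_scale +%R.
Proof.
move=> r; elim/tlq_ind=> a; elim/tlq_ind=> b.
by rewrite -tlqD !tl_quot_scaleE scalerDr tlqD.
Qed.
Lemma tl_quot_scaleDl q : {morph tl_quot_scale^~ q : r s / r + s}.
Proof.
by move=> r s; elim/tlq_ind: q => a; rewrite !tl_quot_scaleE scalerDl tlqD.
Qed.
HB.instance Definition _ := GRing.Zmodule_isLmodule.Build Zx tl_quot
  tl_quot_scaleA tl_quot_scale1 tl_quot_scaleDr tl_quot_scaleDl.

Lemma tl_quot_act_bilinear : bilinear_map tl_quot_act.
Proof.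
split=> [q q' c|q c c'|r q c|r q c].
- elim/tlq_ind: q => a; elim/tlq_ind: q' => b.
  by rewrite -tlqD !tl_quot_actE mulrDl tlqD.
- by elim/tlq_ind: q => a; rewrite !tl_quot_actE mulrDr tlqD.
- elim/tlq_ind: q => a; rewrite [_ *: _ in LHS]tl_quot_scaleE !tl_quot_actE.
  by rewrite [RHS]tl_quot_scaleE scalerAl.
- elim/tlq_ind: q => a; rewrite !tl_quot_actE [RHS]tl_quot_scaleE.
  by rewrite scalerAr.
Qed.
Lemma tl_quot_actM q c d :
  tl_quot_act q (c * d) = tl_quot_act (tl_quot_act q c) d.
Proof. by elim/tlq_ind: q => a; rewrite !tl_quot_actE mulrA. Qed.

(* The right submodule generated by the class of [m_elt n la].               *)
Definition in_cell : {pred tl_quot} :=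
  fun q => `[< exists a, q = tl_quot_act (tlq (m_elt n la)) a >].

Lemma in_cell_submod : submod_closed in_cell.
Proof.
have B := tl_quot_act_bilinear.
split=> [|r q q' /asboolP [a ->] /asboolP [b ->]]; apply/asboolP.
  exists 0; apply: (@addrI _ (tl_quot_act (tlq (m_elt n la)) 0)).
  by rewrite -(bilinDr B) !addr0.
by exists (r *: a + b); rewrite (bilinDr B) (bilinZr B).
Qed.
HB.instance Definition _ :=
  GRing.isSubmodClosed.Build Zx tl_quot in_cell in_cell_submod.

Record cell := Cell { cell_val : tl_quot; cell_valP : cell_val \in in_cell }.
HB.instance Definition _ := [isSub for cell_val].
HB.instance Definition _ := [Choice of cell by <:].
HB.instance Definition _ := [SubChoice_isSubLmodule of cell by <:].

Lemma cell_act_subproof (q : cell) (c : TL n) :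
  tl_quot_act (cell_val q) c \in in_cell.
Proof.
case: q => q /= /asboolP [a ->]; apply/asboolP; exists (a * c).
by rewrite tl_quot_actM.
Qed.
Definition cell_act (q : cell) (c : TL n) : cell :=
  Cell (cell_act_subproof q c).

Lemma cell_act_bilinear : bilinear_map cell_act.
Proof.
have B := tl_quot_act_bilinear.
split=> *; apply: val_inj => /=;
  [exact: bilinDl | exact: bilinDr | exact: bilinZl | exact: bilinZr].
Qed.

Lemma cell_gen_subproof (v : TL n) : tlq (m_elt n la * v) \in in_cell.
Proof. by apply/asboolP; exists v; rewrite tl_quot_actE. Qed.

Definition m_tab (t : tab n la) : cell :=
  Cell (cell_gen_subproof (v_elt n t n)).

(* C^la (x) F and the right action of A_n(x) (x) F on it                     *)
Definition cellF := frac_ext cell.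
HB.instance Definition _ := GRing.Lmodule.on cellF.

Definition cellF_act : cellF -> TLF n -> cellF := tens_bilin cell_act.

End CellModule.

Definition z_elt (n : nat) (T : nat -> TL n) (i : nat) : TL n :=
  if (i < 2)%N then 0 else \sum_(0 <= k < i.+1) ('X ^+ k : Zx) *: T (i - k)%N.

Definition T_next (n i : nat) (T : nat -> TL n) : TL n :=
  - tl_e n i * T i - T i * tl_e n i + tl_e n i * tl_e n i.-1 * T i * tl_e n i
  - z_elt T i.-1 - tl_e n i * z_elt T i.-2.

(* T_(i+1) depends on all of T_0, ..., T_i (through z), so the recursion builds
   the list [T_list n k] = T_0, ..., T_k; see [T_elt_rec].                   *)
Fixpoint T_list (n k : nat) : seq (TL n) :=
  match k with
  | 0 => [:: 0]
  | 1 => [:: 0; 0]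
  | 2 => [:: 0; 0; tl_e n 1]
  | i.+1 => rcons (T_list n i) (T_next i (nth 0 (T_list n i)))
  end.

Definition T_elt (n k : nat) : TL n := nth 0 (T_list n k) k.

Lemma T_list_size n k : size (T_list n k) = k.+1.
Proof.
by elim: k => // -[//|[//|k]] IH; rewrite /= size_rcons -/(T_list n k.+2) IH.
Qed.

Lemma T_list_nth n k j : (j <= k)%N -> nth 0 (T_list n k) j = T_elt n j.
Proof.
elim: k => [|k IH]; first by case: j.
rewrite leq_eqVlt => /orP [/eqP -> // | hj].
rewrite -IH //; case: k hj {IH} => [|[|k]] hj.
- by case: j hj.
- by case: j hj => [|[]].
by rewrite [T_list n k.+3]/= -/(T_list n k.+2) nth_rcons T_list_size hj.
Qed.

Lemma T_elt_rec n i : (2 <= i)%N -> T_elt n i.+1 = T_next i (T_elt n).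
Proof.
case: i => [|[|k]] // _.
rewrite [LHS]/T_elt [T_list n k.+3]/= -/(T_list n k.+2).
rewrite nth_rcons T_list_size ltnn eqxx.
have E j : (j <= k.+2)%N -> nth 0 (T_list n k.+2) j = T_elt n j.
  exact: T_list_nth.
have Z j : (j <= k.+2)%N -> z_elt (nth 0 (T_list n k.+2)) j = z_elt (T_elt n) j.
  move=> hj; rewrite /z_elt; case: ifP => // _; apply: eq_bigr => l _.
  by rewrite E // (leq_trans (leq_subr _ _)).
by rewrite /T_next !E // !Z //= ltnW.
Qed.

Fixpoint p_pol (i : nat) : Zx :=
  match i with
  | 0 => 0
  | 1 => 1
  | (j.+1 as i').+1 => 'X * p_pol i' - p_pol j
  end.

(* When i = (shape s k).1 and k >= 2, the shape of s|_(k-1) is either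
   (i, k - 2i - 1) or (i - 1, k - 2i + 1).                                   *)
Definition r_tab (s : seq (nat * nat)) (k : nat) : Zx :=
  if (k < 2)%N then 0 else
  let i := (shape s k).1 in
  if (shape s k.-1).1 == i
  then (p_pol (k - i).+1 - 'X * p_pol (k - i)) * p_pol i
  else (p_pol i - 'X * p_pol i.-1) * p_pol (k - i).+1.

Definition z_tab (s : seq (nat * nat)) (k : nat) : Zx :=
  \sum_(0 <= i < k.+1) 'X ^+ i * r_tab s (k - i).

Definition r_set (k : nat) : seq Zx :=
  undup (flatten [seq [seq r_tab u k | u : tab k mu] | mu <- parts k]).

Definition F_tab (n : nat) (t : seq (nat * nat)) : TLF n :=
  \prod_(2 <= k < n.+1) \prod_(r <- r_set k | r != r_tab t k)
    ((r_tab t k - r)%:F^-1 *: (tlF (T_elt n k) - r%:F%:A)).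

Definition f_tab (n : nat) (la : nat * nat) (t : tab n la) : cellF n la :=
  cellF_act (tens (m_tab t) 1) (F_tab n t).

(* Main.v *)
(* A tableau is a lattice walk of heights h_k = k - 2 i_k, and A_n(x)
   acts on the F-valued functions on walks by explicit seminormal operators:
   e_k averages over the walks that differ at k only, provided that
   h_(k-1) = h_(k+1). There T_k acts diagonally with eigenvalue r_t(k), because
   z_t(k) = p_i p_(k-i+1) collapses the recursion of T_k to Chebyshev identities,
   and F_t evaluates at the walk t, because the r_t(k) determine t. The ideals
   spanned by m_mu with mu > lambda act by zero, so applying elements to the
   indicator of the lowest walk of shape lambda factors through the cell module,
   and by triangularity f_t goes to a nonzero multiple of the indicator of t.
   Hence the coefficients e_k(s, t) can be read off from the operators. *)
Require Import Defs.
From HB Require Import structures.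
From mathcomp Require Import all_boot all_order all_algebra.
From mathcomp Require Import fraction generic_quotient.
From mathcomp Require Import boolp functions ring zify.

Set Implicit Arguments.
Unset Strict Implicit.
Unset Printing Implicit Defensive.

Import GRing.Theory.
Local Open Scope ring_scope.
Local Open Scope quotient_scope.

(** With x = q + 1/q, p_k is the quantum integer [k]. On two walks that differ at k only, with
    height h at k-1, e_k is a rank one block with diagonal [h+2]/[h+1] at the peak and [h]/[h+1] at
    the valley. Two facts carry the Temperley-Lieb relations: this diagonal sums to x, and the peak
    entry over h is inverse to the valley entry over h+1. Nonvanishing is hard to certify in an
    algebra given by relations, so nothing is computed in the cell module itself. It is mapped to
    functions on walks, where the images of the f_s have disjoint supports; evaluation at the walk
    of s isolates e_k(s,t). The normalisation e_k(s,t) = 1 of (4) dictates how the functions compare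
    with the f_s: a factor 1/p_h for every step down from height h. The ratios in (4) are
    p_(h+2)/p_(h+1) at a peak and (-p_h)/(-p_(h+1)) at a valley. *)

Record tl_module (n : nat) (V : lmodType Zx_frac) := TLModule {
  tl_gen :> nat -> {linear V -> V};
  tl_gen_sqr : forall i v, (0 < i < n)%N ->
    tl_gen i (tl_gen i v) = 'X%:F *: tl_gen i v;
  tl_gen_braid : forall i j v, (0 < i < n)%N -> (0 < j < n)%N ->
    (j == i.+1) || (i == j.+1) -> tl_gen i (tl_gen j (tl_gen i v)) = tl_gen i v;
  tl_gen_comm : forall i j v, (0 < i < n)%N -> (0 < j < n)%N ->
    (i.+2 <= j)%N -> tl_gen i (tl_gen j v) = tl_gen j (tl_gen i v)
}.

(** * Right actions of the algebra and of its extension to F, from operators for the generators *)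

Section RightAction.

Variables (n : nat) (V : lmodType Zx_frac) (E : tl_module n V).

Fixpoint term_act (v : V) (a : tl_term n) : V :=
  match a with
  | TLConst r => r%:F *: v
  | TLGen i => E (val i) v
  | TLOpp b => - term_act v b
  | TLAdd b c => term_act v b + term_act v c
  | TLMul b c => term_act (term_act v b) c
  end.

Lemma term_act_linear (s : Zx_frac) v w a :
  term_act (s *: v + w) a = s *: term_act v a + term_act w a.
Proof.
elim: a v w => [r|i|b IH|b IHb c IHc|b IHb c IHc] v w /=.
- by rewrite scalerDr !scalerA mulrC.
- exact: linearP.
- by rewrite IH opprD scalerN.
- by rewrite IHb IHc addrACA scalerDr.
- by rewrite IHb IHc.
Qed.

Lemma term_actD v w a : term_act (v + w) a = term_act v a + term_act w a.
Proof. by rewrite -[v]scale1r term_act_linear !scale1r. Qed.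

Lemma term_act0 a : term_act 0 a = 0.
Proof. by apply: (@addrI _ (term_act 0 a)); rewrite -term_actD !addr0. Qed.

Lemma term_actZ s v a : term_act (s *: v) a = s *: term_act v a.
Proof. by rewrite -[s *: v]addr0 term_act_linear term_act0 addr0. Qed.

(** The defining relations are invariant under reversing words, so the operator identities of
    [tl_module] serve a right action as well; linearity of the operators accounts for [tl_mulDl] and
    [tl_constC]. *)
Lemma term_act_eq a b : tl_eq a b -> forall v, term_act v a = term_act v b.
Proof.
elim=> {a b} /=.
- by [].
- by move=> a b _ IH v; rewrite IH.
- by move=> b a c _ IH1 _ IH2 v; rewrite IH1 IH2.
- by move=> a a' _ IH v; rewrite IH.
- by move=> a a' b b' _ IH1 _ IH2 v; rewrite IH1 IH2.
- by move=> a a' b b' _ IH1 _ IH2 v; rewrite IH1 IH2.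
- by move=> a b c v; rewrite addrA.
- by move=> a b v; rewrite addrC.
- by move=> a v; rewrite tofrac0 scale0r add0r.
- by move=> a v; rewrite tofrac0 scale0r addNr.
- by [].
- by move=> a v; rewrite tofrac1 scale1r.
- by move=> a v; rewrite tofrac1 scale1r.
- by move=> a b c v; rewrite term_actD.
- by [].
- by move=> r s v; rewrite tofracD scalerDl.
- by move=> r s v; rewrite scalerA tofracM mulrC.
- by move=> r a v; rewrite term_actZ.
- by move=> i v; rewrite tl_gen_sqr ?(valP i) // linearZ.
- by move=> i j ij v; rewrite tl_gen_braid ?(valP i) ?(valP j).
- move=> i j ij v; case/orP: ij => ij.
    by rewrite -tl_gen_comm ?(valP i) ?(valP j).
  by rewrite tl_gen_comm ?(valP i) ?(valP j).
Qed.

Definition tl_act (v : V) (a : TL n) : V := term_act v (repr a).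

Lemma tl_act_pi v (a : tl_term n) : tl_act v (\pi_(TL n) a) = term_act v a.
Proof. by apply: term_act_eq; exact: tl_repr. Qed.

Lemma tl_actD v a b : tl_act v (a + b) = tl_act v a + tl_act v b.
Proof.
elim/quotW: a => a; elim/quotW: b => b.
by rewrite [_ + _ in LHS]tlq_addE !tl_act_pi.
Qed.

Lemma tl_actN v a : tl_act v (- a) = - tl_act v a.
Proof. by elim/quotW: a => a; rewrite [- _ in LHS]tlq_oppE !tl_act_pi. Qed.

Lemma tl_actB v a b : tl_act v (a - b) = tl_act v a - tl_act v b.
Proof. by rewrite tl_actD tl_actN. Qed.

Lemma tl_actM v a b : tl_act v (a * b) = tl_act (tl_act v a) b.
Proof.
elim/quotW: a => a; elim/quotW: b => b.
by rewrite [_ * _ in LHS]tlq_mulE !tl_act_pi.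
Qed.

Lemma tl_actZ v r a : tl_act v (r *: a) = r%:F *: tl_act v a.
Proof.
elim/quotW: a => a; rewrite [_ *: _ in LHS]tlq_scaleE !tl_act_pi /=.
exact: term_actZ.
Qed.

Lemma tl_act0 v : tl_act v 0 = 0.
Proof. by rewrite -[0](subrr 0) tl_actB subrr. Qed.

Lemma tl_act1 v : tl_act v 1 = v.
Proof.
by rewrite [1 in LHS](_ : 1 = \pi_(TL n) (TLConst n 1)) // tl_act_pi /= tofrac1 scale1r.
Qed.

Lemma tl_act_sum (I : Type) (r : seq I) (P : pred I) (a : I -> TL n) v :
  tl_act v (\sum_(i <- r | P i) a i) = \sum_(i <- r | P i) tl_act v (a i).
Proof. exact: (big_morph (tl_act v) (tl_actD v) (tl_act0 v)). Qed.

Lemma tl_act_e v k : (0 < k < n)%N -> tl_act v (tl_e n k) = E k v.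
Proof.
move=> hk; rewrite /tl_e; case: insubP => [j _ jk|]; last by rewrite hk.
by rewrite tl_act_pi /= jk.
Qed.

Lemma tl_actDl v w a : tl_act (v + w) a = tl_act v a + tl_act w a.
Proof. exact: term_actD. Qed.

Lemma tl_act0l a : tl_act 0 a = 0.
Proof. exact: term_act0. Qed.

Lemma tl_actZl s v a : tl_act (s *: v) a = s *: tl_act v a.
Proof. exact: term_actZ. Qed.

Lemma tl_act_balanced v : balanced (fun (a : TL n) s => s *: tl_act v a).
Proof.
split=> [a b s|a s s'|r a s].
- by rewrite tl_actD scalerDr.
- exact: scalerDl.
- by rewrite tl_actZ scalerA mulrC.
Qed.

Definition tlf_act (v : V) (y : TLF n) : V :=
  tens_lift (fun (a : TL n) s => s *: tl_act v a) y.

Lemma tlf_actE v a s : tlf_act v (tens a s) = s *: tl_act v a.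
Proof. exact: tens_liftE (tl_act_balanced v) _ _. Qed.

Lemma tlf_act0 v : tlf_act v 0 = 0.
Proof. exact: tens_lift0 (tl_act_balanced v). Qed.

Lemma tlf_actN v y : tlf_act v (- y) = - tlf_act v y.
Proof. exact: tens_liftN (tl_act_balanced v) _. Qed.

Lemma tlf_actD v y z : tlf_act v (y + z) = tlf_act v y + tlf_act v z.
Proof. exact: tens_liftD (tl_act_balanced v) _ _. Qed.

Lemma tlf_act_tlF v a : tlf_act v (tlF a) = tl_act v a.
Proof. by rewrite tlf_actE scale1r. Qed.

Lemma tlf_actZl c v y : tlf_act (c *: v) y = c *: tlf_act v y.
Proof.
elim/frac_ext_ind: y => [a s||y IH|y z IHy IHz].
- by rewrite !tlf_actE tl_actZl !scalerA mulrC.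
- by rewrite !tlf_act0 scaler0.
- by rewrite !tlf_actN IH scalerN.
- by rewrite !tlf_actD IHy IHz scalerDr.
Qed.

Lemma tlf_act0l y : tlf_act 0 y = 0.
Proof. by rewrite -[0 in LHS](scale0r 0) tlf_actZl scale0r. Qed.

Lemma tlf_actDl v w y : tlf_act (v + w) y = tlf_act v y + tlf_act w y.
Proof.
elim/frac_ext_ind: y => [a s||y IH|y z IHy IHz].
- by rewrite !tlf_actE tl_actDl scalerDr.
- by rewrite !tlf_act0 addr0.
- by rewrite !tlf_actN IH opprD.
- by rewrite !tlf_actD IHy IHz addrACA.
Qed.

Lemma tlf_actNl v y : tlf_act (- v) y = - tlf_act v y.
Proof. by rewrite -scaleN1r tlf_actZl scaleN1r. Qed.

Lemma tlf_act1 v : tlf_act v 1 = v.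
Proof. by rewrite tlf_actE tl_act1 scale1r. Qed.

Lemma tlf_actZ c v y : tlf_act v (c *: y) = c *: tlf_act v y.
Proof.
elim/frac_ext_ind: y => [a s||y IH|y z IHy IHz].
- by rewrite frac_ext_scaleE !tlf_actE scalerA.
- by rewrite scaler0 tlf_act0 scaler0.
- by rewrite scalerN !tlf_actN IH scalerN.
- by rewrite scalerDr !tlf_actD IHy IHz scalerDr.
Qed.

Lemma tlf_actM v y z : tlf_act v (y * z) = tlf_act (tlf_act v y) z.
Proof.
elim/frac_ext_ind: y => [a s||y IH|y y' IHy IHz].
- elim/frac_ext_ind: z => [b r||z IH|z z' IHz IHz'].
  + rewrite [_ * _ in LHS](tens_bilinE (tl_mul_bilinear n)) !tlf_actE.
    by rewrite tl_actM tl_actZl scalerA mulrC.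
  + by rewrite mulr0 !tlf_act0.
  + by rewrite mulrN !tlf_actN IH.
  + by rewrite mulrDr !tlf_actD IHz IHz'.
- by rewrite mul0r tlf_act0 tlf_act0l.
- by rewrite mulNr !tlf_actN tlf_actNl IH.
- by rewrite mulrDl !tlf_actD tlf_actDl IHy IHz.
Qed.

End RightAction.

(** * Linear maps out of the cell module *)

Section CellLift.

Variables (n : nat) (la : nat * nat) (V : lmodType Zx_frac).
Variables (E : tl_module n V) (xi : V).
Hypothesis check0 : forall v a, a \in check_ideal n la -> tl_act E v a = 0.

Lemma tl_act_tlq (a b : TL n) :
  tlq la a = tlq la b -> tl_act E xi a = tl_act E xi b.
Proof. by move/tlq_eq/(check0 xi)/eqP; rewrite tl_actB subr_eq0 => /eqP. Qed.

(** A map defined on the submodule generated by [m_elt n la] alone would involve the annihilator of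
    that generator. On the whole quotient, a |-> xi a needs only [check0], and the cell module
    inherits the restriction. *)
Definition quot_lift (q : tl_quot n la) : V := tl_act E xi (repr q).

Lemma quot_lift_tlq a : quot_lift (tlq la a) = tl_act E xi a.
Proof. by apply: tl_act_tlq; exact: reprK. Qed.

Lemma quot_liftD q q' : quot_lift (q + q') = quot_lift q + quot_lift q'.
Proof.
elim/tlq_ind: q => a; elim/tlq_ind: q' => b.
by rewrite -tlqD !quot_lift_tlq tl_actD.
Qed.

Lemma quot_liftZ r q : quot_lift (r *: q) = r%:F *: quot_lift q.
Proof.
by elim/tlq_ind: q => a; rewrite [_ *: _ in LHS]tl_quot_scaleE !quot_lift_tlq tl_actZ.
Qed.

Lemma quot_lift_act q c :
  quot_lift (tl_quot_act q c) = tl_act E (quot_lift q) c.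
Proof. by elim/tlq_ind: q => a; rewrite tl_quot_actE !quot_lift_tlq tl_actM. Qed.

Lemma cell_lift_balanced :
  balanced (fun (q : cell n la) s => s *: quot_lift (cell_val q)).
Proof.
split=> [q q' s|q s s'|r q s].
- by rewrite quot_liftD scalerDr.
- exact: scalerDl.
- by rewrite quot_liftZ scalerA mulrC.
Qed.

Definition cell_lift : cellF n la -> V :=
  tens_lift (fun (q : cell n la) s => s *: quot_lift (cell_val q)).

Let B := cell_lift_balanced.

Lemma cell_liftZ c x : cell_lift (c *: x) = c *: cell_lift x.
Proof.
rewrite /cell_lift; elim/frac_ext_ind: x => [q s||x IH|x y IHx IHy].
- by rewrite frac_ext_scaleE !(tens_liftE B) scalerA.
- by rewrite scaler0 (tens_lift0 B) scaler0.
- by rewrite scalerN !(tens_liftN B) IH scalerN.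
- by rewrite scalerDr !(tens_liftD B) IHx IHy scalerDr.
Qed.

Lemma cell_lift_sum (I : Type) (r : seq I) (P : pred I) (x : I -> cellF n la) :
  cell_lift (\sum_(i <- r | P i) x i) = \sum_(i <- r | P i) cell_lift (x i).
Proof. exact: (big_morph cell_lift (tens_liftD B) (tens_lift0 B)). Qed.

Lemma cell_lift_act x y : cell_lift (cellF_act x y) = tlf_act E (cell_lift x) y.
Proof.
have C := @cell_act_bilinear n la; rewrite /cell_lift /cellF_act.
elim/frac_ext_ind: x => [q s||x IH|x x' IHx IHx'].
- elim/frac_ext_ind: y => [a r||y IH|y y' IHy IHy'].
  + rewrite (tens_bilinE C) !(tens_liftE B) tlf_actE /= quot_lift_act.
    by rewrite tl_actZl scalerA mulrC.
  + by rewrite (tens_bilin0r C) (tens_lift0 B) tlf_act0.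
  + by rewrite (tens_bilinNr C) (tens_liftN B) IH tlf_actN.
  + by rewrite (tens_bilinDr C) (tens_liftD B) IHy IHy' tlf_actD.
- by rewrite (tens_bilin0l C) (tens_lift0 B) tlf_act0l.
- by rewrite (tens_bilinNl C) !(tens_liftN B) IH tlf_actNl.
- by rewrite (tens_bilinDl C) !(tens_liftD B) IHx IHx' tlf_actDl.
Qed.

Lemma cell_lift_m_tab (t : tab n la) :
  cell_lift (tens (m_tab t) 1) = tl_act E xi (m_elt n la * v_elt n t n).
Proof. by rewrite /cell_lift (tens_liftE B) scale1r /= quot_lift_tlq. Qed.

End CellLift.

(** * Chebyshev identities for p_k *)

Local Notation p_frac k := ((p_pol k)%:F : Zx_frac).

Lemma p_polSS k : p_pol k.+2 = 'X * p_pol k.+1 - p_pol k.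
Proof. by []. Qed.

Lemma p_pol0 : p_pol 0 = 0.
Proof. by []. Qed.

Lemma p_pol1 : p_pol 1 = 1.
Proof. by []. Qed.

Local Opaque p_pol.

Lemma size_p_pol k : size (p_pol k) = k.
Proof.
suff [] : size (p_pol k) = k /\ size (p_pol k.+1) = k.+1 by [].
elim: k => [|k [IH1 IH2]]; first by rewrite p_pol0 p_pol1 size_poly0 size_poly1.
split=> //; rewrite p_polSS.
have h : size ('X * p_pol k.+1) = k.+2.
  by rewrite mulrC size_mulX ?IH2 // -size_poly_eq0 IH2.
by rewrite size_polyDl h // size_polyN IH1.
Qed.

Lemma p_frac_neq0 k : p_frac k.+1 != 0.
Proof. by rewrite tofrac_eq0 -size_poly_eq0 size_p_pol. Qed.

Lemma p_fracSS k : p_frac k.+2 = 'X%:F * p_frac k.+1 - p_frac k.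
Proof. by rewrite p_polSS tofracB tofracM. Qed.

Lemma p_pol_addn a b : p_pol (a + b).+1 = p_pol a.+1 * p_pol b.+1 - p_pol a * p_pol b.
Proof.
elim: a b => [|a IH] b; first by rewrite p_pol0 p_pol1 mul1r mul0r subr0.
rewrite addSnnS IH !p_polSS; ring.
Qed.

(** The right-hand side is the Casoratian of two solutions of the same recurrence, hence independent
    of b; at b = 0 it is p_d. *)
Lemma p_pol_subn d b :
  p_pol d = p_pol (b + d) * p_pol b.+1 - p_pol (b + d).+1 * p_pol b.
Proof.
elim: b => [|b IH]; first by rewrite p_pol0 p_pol1 mulr1 mulr0 subr0.
rewrite [LHS]IH addSn !p_polSS; ring.
Qed.

(* The tableau t is encoded by the first coordinates c(k) of the shapes of its
   truncations; the one-row diagram t^(k) has [ht c k] boxes. *)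
Definition walk := nat -> nat.

Definition upd (c : walk) (k v : nat) : walk :=
  fun j => if j == k then v else c j.

Lemma updE c k v : upd c k v k = v.
Proof. by rewrite /upd eqxx. Qed.

Lemma upd_neq c k v j : j != k -> upd c k v j = c j.
Proof. by rewrite /upd => /negbTE ->. Qed.

Lemma upd_upd c k v w : upd (upd c k v) k w = upd c k w.
Proof. by apply/funext => j; rewrite /upd; case: eqP. Qed.

Lemma upd_id c k v : c k = v -> upd c k v = c.
Proof. by move=> <-; apply/funext => j; rewrite /upd; case: eqP => [->|]. Qed.

Lemma updC c k l v w : k != l -> upd (upd c k v) l w = upd (upd c l w) k v.
Proof.
move=> kl; apply/funext => j; rewrite /upd.
by case: eqP => [->|//]; rewrite eq_sym (negbTE kl).
Qed.

(** * Seminormal operators on functions on walks, and the Temperley-Lieb relations *)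

Section Walks.

Variables n f : nat.

(** [walk_out] makes walks that agree up to n equal as functions; the value 0 matches the default of
    [nth] in [shape]. *)
Record is_walk (c : walk) : Prop := IsWalk {
  walk0 : c 0%N = 0%N;
  walk_step : forall k, (k < n)%N -> c k.+1 = c k \/ c k.+1 = (c k).+1;
  walk_half : forall k, (k <= n)%N -> ((c k).*2 <= k)%N;
  walk_end : c n = f;
  walk_out : forall k, (n < k)%N -> c k = 0%N
}.

Definition ht (c : walk) (k : nat) : nat := (k - (c k).*2)%N.

(** The heights at k.-1 and k.+1 agree: k is a peak if c k = c k.-1 and a valley if c k = (c
    k.-1).+1. Including [is_walk] makes the operators vanish off the walks. *)
Definition turns (k : nat) (c : walk) : bool :=
  `[< is_walk c >] && (c k.+1 == (c k.-1).+1).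

Lemma turnsP k c : reflect (is_walk c /\ c k.+1 = (c k.-1).+1) (turns k c).
Proof.
by apply: (iffP andP) => -[h1 h2]; split; do ?[exact/asboolP | exact/eqP].
Qed.

Definition w_up h : Zx_frac := p_frac h.+2 / p_frac h.+1.
Definition w_dn h : Zx_frac := p_frac h / p_frac h.+1.

(* The seminormal basis vectors are rescaled (see [walk_weight]) so that both
   rows of each 2 x 2 block of e_k are equal to (w_up, w_dn). At height 0 the
   coordinate (c k.-1).+1 does not give a walk, but then w_dn = 0. *)
Definition walk_gen (k : nat) (psi : walk -> Zx_frac^o) : walk -> Zx_frac^o :=
  fun c => if turns k c then
      w_up (ht c k.-1) * psi (upd c k (c k.-1)) +
      w_dn (ht c k.-1) * psi (upd c k (c k.-1).+1)
    else 0.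

Lemma walk_gen_linear k : linear (walk_gen k).
Proof.
move=> a u v; apply/funext => c; rewrite /walk_gen !fctE /=.
by case: ifP => _ /=; rewrite ?scaler0 ?addr0 // /GRing.scale /=; ring.
Qed.
HB.instance Definition _ k := GRing.isLinear.Build Zx_frac
  (walk -> Zx_frac^o) (walk -> Zx_frac^o) _ (walk_gen k) (walk_gen_linear k).

Lemma w_dn0 : w_dn 0 = 0.
Proof. by rewrite /w_dn p_pol0 tofrac0 mul0r. Qed.

Lemma w_upD_w_dn h : w_up h + w_dn h = 'X%:F.
Proof.
rewrite /w_up /w_dn -mulrDl p_fracSS subrK mulfK //; exact: p_frac_neq0.
Qed.

Lemma w_up_dn h : w_up h * w_dn h.+1 = 1.
Proof. by rewrite /w_up /w_dn mulrA divfK ?divff ?p_frac_neq0. Qed.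

Lemma w_dn_up h : w_dn h.+1 * w_up h = 1.
Proof. by rewrite mulrC w_up_dn. Qed.

Lemma is_walk_upd c k v : (0 < k < n)%N -> is_walk c ->
  c k.+1 = (c k.-1).+1 -> v = c k.-1 \/ v = (c k.-1).+1 -> (v.*2 <= k)%N ->
  is_walk (upd c k v).
Proof.
case: k => [//|k] /= kn [c0 cs ch cn co] ck vk hv; split.
- by rewrite upd_neq.
- move=> j jn; rewrite /upd.
  case: (eqVneq j.+1 k.+1) => [[jk]|jk]; case: (eqVneq j k.+1) => [jk'|jk'].
  + lia.
  + by rewrite jk; lia.
  + by rewrite jk' ck; lia.
  + exact: cs.
- by move=> j jn; rewrite /upd; case: eqP => [->|_] //; apply: ch.
- by rewrite upd_neq //; lia.
- by move=> j jn; rewrite upd_neq ?co //; lia.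
Qed.

Lemma walk_gen_out k psi c : ~~ turns k c -> walk_gen k psi c = 0.
Proof. by rewrite /walk_gen => /negbTE ->. Qed.

Lemma turns_upd k c : (0 < k < n)%N -> turns k c ->
  turns k (upd c k (c k.-1)) /\
  ((0 < ht c k.-1)%N -> turns k (upd c k (c k.-1).+1)).
Proof.
move=> kn /turnsP [pc ck].
have hk : ((c k.-1).*2 <= k.-1)%N by apply: (walk_half pc); lia.
split=> [|ht0]; apply/turnsP; split.
- by apply: is_walk_upd => //; [left | lia].
- by rewrite !upd_neq //; lia.
- by apply: is_walk_upd => //; [right | move: ht0; rewrite /ht; lia].
- by rewrite !upd_neq //; lia.
Qed.

Lemma ht_upd c k j v : j != k -> ht (upd c k v) j = ht c j.
Proof. by move=> jk; rewrite /ht upd_neq. Qed.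

(** Both rows of a block are equal, so the result does not see the value of the walk at k. This rank
    one shape underlies the quadratic and braid relations. *)
Lemma walk_gen_upd k psi c v : (0 < k)%N -> turns k c -> turns k (upd c k v) ->
  walk_gen k psi (upd c k v) = walk_gen k psi c.
Proof.
move=> k0 tc tv; rewrite /walk_gen tc tv !upd_upd ht_upd ?upd_neq //; lia.
Qed.

Lemma walk_gen_sqr k psi : (0 < k < n)%N ->
  walk_gen k (walk_gen k psi) = 'X%:F *: walk_gen k psi.
Proof.
move=> kn; apply/funext => c; rewrite [RHS]/GRing.scale /=.
rewrite {1}/walk_gen; case: ifP => tc; last first.
  by rewrite walk_gen_out ?tc //= scaler0.
have [t1 t2] := turns_upd kn tc.
rewrite walk_gen_upd //; last by lia.
have [h0|hp] := posnP (ht c k.-1).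
  rewrite h0 w_dn0 mul0r addr0.
  (* At height 0 only the peak is a walk, and its weight [w_up 0] is all of x. *)
  by rewrite -[w_up 0]addr0 -w_dn0 w_upD_w_dn.
rewrite walk_gen_upd //; [| by lia | exact: t2].
by rewrite -mulrDl w_upD_w_dn.
Qed.

(** Covering both orders of i and j reduces commutation to the symmetry of this expansion. *)
Lemma walk_gen_far i j psi c : (0 < i < n)%N -> (0 < j < n)%N ->
  (i.+2 <= j)%N || (j.+2 <= i)%N ->
  walk_gen i (walk_gen j psi) c =
    if turns i c && turns j c then
      w_up (ht c i.-1) *
        (w_up (ht c j.-1) * psi (upd (upd c i (c i.-1)) j (c j.-1)) +
         w_dn (ht c j.-1) * psi (upd (upd c i (c i.-1)) j (c j.-1).+1)) +
      w_dn (ht c i.-1) *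
        (w_up (ht c j.-1) * psi (upd (upd c i (c i.-1).+1) j (c j.-1)) +
         w_dn (ht c j.-1) * psi (upd (upd c i (c i.-1).+1) j (c j.-1).+1))
    else 0.
Proof.
move=> hi hj ij; have [ti|ti] := boolP (turns i c); last exact: walk_gen_out.
have key v : turns i (upd c i v) -> walk_gen j psi (upd c i v) =
    if turns j c then
      w_up (ht c j.-1) * psi (upd (upd c i v) j (c j.-1)) +
      w_dn (ht c j.-1) * psi (upd (upd c i v) j (c j.-1).+1) else 0.
  move=> /turnsP [pv _]; case/turnsP: ti => [pc _].
  rewrite {1}/walk_gen ht_upd ?(upd_neq _ _ (j := j.-1)); [|by lia..].
  congr (if _ then _ else _).
  by apply/turnsP/turnsP => -[_ h]; split=> //; move: h; rewrite !upd_neq //; lia.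
have [t1 t2] := turns_upd hi ti.
rewrite {1}/walk_gen ti (key _ t1) /=.
have [h0|hp] := posnP (ht c i.-1).
  by rewrite h0 w_dn0 !mul0r !addr0; case: ifP; rewrite ?mulr0.
by rewrite (key _ (t2 hp)); case: ifP; rewrite // !mulr0 addr0.
Qed.

Lemma walk_gen_comm i j psi : (0 < i < n)%N -> (0 < j < n)%N -> (i.+2 <= j)%N ->
  walk_gen i (walk_gen j psi) = walk_gen j (walk_gen i psi).
Proof.
move=> hi hj ij; apply/funext => c.
rewrite !walk_gen_far ?ij ?orbT // andbC; case: ifP => // _.
have ji : j != i by lia.
rewrite !(updC c _ _ ji).
move: (w_up _) (w_dn _) (w_up _) (w_dn _) => a b a' b'; ring.
Qed.

Lemma turns_succ k c v : (0 < k)%N -> (k.+1 < n)%N -> turns k c ->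
  turns k (upd c k v) -> turns k.+1 (upd c k v) = (c k.+2 == v.+1).
Proof.
move=> k0 kn /turnsP [pc ck] /turnsP [pv _].
apply/turnsP/eqP => [[_]|h] /=; rewrite /= updE upd_neq //; lia.
Qed.

Lemma turns_pred k c v : (1 < k)%N -> (k < n)%N -> turns k c ->
  turns k (upd c k v) -> turns k.-1 (upd c k v) = (v == (c k.-2).+1).
Proof.
move=> k1 kn /turnsP [pc ck] /turnsP [pv _].
have e : k.-1.+1 = k by lia.
apply/turnsP/eqP => [[_]|h]; rewrite e updE upd_neq //; lia.
Qed.

(* Of the two walks in the block of c at k, exactly one turns at k.+1, and only
   one of its two modifications at k.+1 turns at k: it is that walk itself. *)
Lemma walk_gen_braid_up k psi : (0 < k)%N -> (k.+1 < n)%N ->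
  walk_gen k (walk_gen k.+1 (walk_gen k psi)) = walk_gen k psi.
Proof.
move=> k0 kn; apply/funext => c; have kn' : (0 < k < n)%N by lia.
have [tc|tc] := boolP (turns k c); last by rewrite !walk_gen_out.
have [t1 t2] := turns_upd kn' tc; case/turnsP: (tc) => [pc ck].
have step2 := walk_step pc kn.
have hk : ((c k.-1).*2 <= k.-1)%N by apply: (walk_half pc); lia.
have hk2 : ((c k.+2).*2 <= k.+2)%N by apply: (walk_half pc); lia.
have inner v w : v = c k.-1 \/ v = (c k.-1).+1 -> turns k (upd c k v) ->
    is_walk (upd (upd c k v) k.+1 w) ->
    walk_gen k psi (upd (upd c k v) k.+1 w) =
    if w == (c k.-1).+1 then walk_gen k psi c else 0.
  move=> hv tv pw; case: eqP => [ew|nw].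
    rewrite (_ : upd _ k.+1 w = upd c k v) ?walk_gen_upd //; last first.
    by rewrite upd_id // upd_neq ?ck //; lia.
  rewrite walk_gen_out //; apply/negP => /turnsP [_].
  by rewrite updE !upd_neq; lia.
have outer v : v = c k.-1 \/ v = (c k.-1).+1 -> turns k (upd c k v) ->
    walk_gen k.+1 (walk_gen k psi) (upd c k v) =
    (if c k.+2 == v.+1 then
      (if v == c k.-1 then w_dn (k - v.*2) else w_up (k - v.*2)) else 0) *
      walk_gen k psi c.
  move=> hv tv; have tS := turns_succ k0 kn tc tv.
  rewrite {1}/walk_gen tS; case: ifP => [|_]; rewrite ?mul0r // -tS => tSv.
  have kn1 : (0 < k.+1 < n)%N by lia.
  have [s1 s2] := turns_upd kn1 tSv; move: s1 s2; rewrite /= !updE /ht updE.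
  move=> /turnsP [s1 _] s2; rewrite inner //.
  have [h0|hp] := posnP (k - v.*2)%N.
    rewrite h0 w_dn0 mul0r addr0.
    by case: hv => ->; rewrite ?eqxx; (do ?case: eqP); rewrite ?mulr0 ?mul0r //; lia.
  case/turnsP: (s2 hp) => [{}s2 _]; rewrite inner //.
  case: hv => ->; rewrite eqxx; (do ?case: eqP) => *; rewrite ?mulr0 ?add0r ?addr0 //; lia.
rewrite {1}/walk_gen tc outer //; last by left.
have [h0|hp] := posnP (ht c k.-1).
  have -> : c k.+2 = (c k.-1).+1 by move: h0; rewrite /ht; lia.
  rewrite h0 w_dn0 mul0r addr0 !eqxx mulrA.
  have -> : (k - (c k.-1).*2 = 1)%N by move: h0; rewrite /ht; lia.
  by rewrite w_up_dn mul1r.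
rewrite outer; [|by right|exact: t2].
rewrite !mulrA -mulrDl (_ : _ + _ = 1) ?mul1r // eqxx.
have [h hE] : exists h, ht c k.-1 = h.+1 by exists (ht c k.-1).-1; lia.
rewrite (_ : (k - (c k.-1).*2)%N = h.+2); last by move: hE; rewrite /ht; lia.
rewrite (_ : (k - (c k.-1).+1.*2)%N = h); last by move: hE; rewrite /ht; lia.
(* If the step after k.+1 goes up, the peak at k is the walk that turns at k.+1, with weight
   [w_dn h.+2]; if it goes down, the valley does, with weight [w_up h]. *)
rewrite hE; case: step2 => ->; rewrite ck.
  rewrite eqxx; case: eqP => [|_]; first by lia.
  by rewrite w_up_dn mulr0 addr0.
case: eqP => [|_]; first by lia.
rewrite eqxx; case: eqP => [|_]; first by lia.
by rewrite w_dn_up mulr0 add0r.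
Qed.

(** Turning at k.-1 forces v = (c k.-2).+1, and of the two modifications at k.-1 only the one that
    keeps the value c k.-1 still turns at k. The formula serves both the braid relation and the
    recursion of T. *)
Lemma walk_gen_pred_upd k psi c v : (1 < k)%N -> (k < n)%N -> turns k c ->
  turns k (upd c k v) ->
  walk_gen k.-1 (walk_gen k psi) (upd c k v) =
    (if v == (c k.-2).+1 then
       if c k.-1 == c k.-2 then w_up (ht c k.-2) else w_dn (ht c k.-2)
     else 0) * walk_gen k psi c.
Proof.
move=> k1 kn tc tv; have tp := turns_pred k1 kn tc tv.
have [/= pc ck] := turnsP _ _ tc; have [/= pv _] := turnsP _ _ tv.
have k2n : (k.-2 < n)%N by lia.
have step2 := walk_step pc k2n; have e1 : k.-2.+1 = k.-1 by lia.
have e2 : k.-1.+1 = k by lia.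
rewrite e1 in step2.
have inner w : is_walk (upd (upd c k v) k.-1 w) ->
    walk_gen k psi (upd (upd c k v) k.-1 w) =
    if w == c k.-1 then walk_gen k psi c else 0.
  move=> pw; case: eqP => [ew|nw].
    rewrite (_ : upd _ k.-1 w = upd c k v) ?walk_gen_upd //; first by lia.
    by rewrite upd_id // upd_neq ?ck //; lia.
  rewrite walk_gen_out //; apply/negP => /turnsP [_].
  by rewrite updE !upd_neq; lia.
rewrite {1}/walk_gen tp; case: ifP => [|_]; rewrite ?mul0r // -tp => tvp.
have kn1 : (0 < k.-1 < n)%N by lia.
have [s1 s2] := turns_upd kn1 tvp; move: s1 s2.
rewrite ht_upd ?(upd_neq _ _ (j := k.-2)); [|by lia..].
move=> /turnsP [s1 _] s2; rewrite inner //.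
have [h0|hp] := posnP (ht c k.-2).
  have hk : ((c k.-1).*2 <= k.-1)%N by apply: (walk_half pc); lia.
  have -> : c k.-1 = c k.-2 by move: h0; rewrite /ht; lia.
  by rewrite h0 w_dn0 !eqxx mul0r addr0.
case/turnsP: (s2 hp) => [{}s2 _]; rewrite inner //.
case: step2 => ->; first by rewrite eqxx; case: eqP; rewrite ?mulr0 ?addr0 //; lia.
rewrite eqxx; case: eqP; first by lia.
by case: eqP; rewrite ?mulr0 ?add0r //; lia.
Qed.

(* The coefficient of [walk_gen_pred_upd] is the inverse of the coefficient
   of [upd c k v] in [walk_gen k psi c]. *)
Lemma walk_gen_braid_down k psi : (1 < k)%N -> (k < n)%N ->
  walk_gen k (walk_gen k.-1 (walk_gen k psi)) = walk_gen k psi.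
Proof.
move=> k1 kn; apply/funext => c; have kn' : (0 < k < n)%N by lia.
have [tc|tc] := boolP (turns k c); last by rewrite !walk_gen_out.
have [t1 t2] := turns_upd kn' tc; case/turnsP: (tc) => [pc ck].
have k2n : (k.-2 < n)%N by lia.
have step2 := walk_step pc k2n; rewrite (_ : k.-2.+1 = k.-1) in step2; last by lia.
have hk : ((c k.-1).*2 <= k.-1)%N by apply: (walk_half pc); lia.
have hk2 : ((c k.-2).*2 <= k.-2)%N by apply: (walk_half pc); lia.
rewrite {1}/walk_gen tc walk_gen_pred_upd //.
have [h0|hp] := posnP (ht c k.-1).
  have e : c k.-1 = (c k.-2).+1 by move: h0; rewrite /ht; lia.
  rewrite e eqxx h0 w_dn0 mul0r addr0 ifF; last by apply/eqP; lia.
  rewrite (_ : ht c k.-2 = 1%N); last by move: h0; rewrite /ht; lia.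
  by rewrite mulrA w_up_dn mul1r.
rewrite walk_gen_pred_upd //; last exact: t2.
rewrite !mulrA -mulrDl (_ : _ + _ = 1) ?mul1r //.
case: step2 => e; rewrite e eqxx; (do ?[case: eqP => [|_]; first by lia]).
  rewrite (_ : ht c k.-1 = (ht c k.-2).+1); last by rewrite /ht; lia.
  by rewrite ?eqxx w_dn_up mulr0 add0r.
rewrite (_ : ht c k.-2 = (ht c k.-1).+1); last by move: hp; rewrite /ht; lia.
by rewrite w_up_dn mulr0 addr0.
Qed.

Lemma walk_gen_braid i j psi : (0 < i < n)%N -> (0 < j < n)%N ->
  (j == i.+1) || (i == j.+1) ->
  walk_gen i (walk_gen j (walk_gen i psi)) = walk_gen i psi.
Proof.
move=> hi hj /orP [/eqP jE | /eqP iE].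
  by rewrite jE; apply: walk_gen_braid_up; lia.
by rewrite (_ : j = i.-1) ?walk_gen_braid_down //; lia.
Qed.

Definition walk_module : tl_module n (walk -> Zx_frac^o) :=
  TLModule walk_gen_sqr walk_gen_braid walk_gen_comm.

End Walks.

(** * The values r and z along a walk *)

Definition r_walk (c : walk) (k : nat) : Zx :=
  if (k < 2)%N then 0 else
  if c k.-1 == c k
  then (p_pol (k - c k).+1 - 'X * p_pol (k - c k)) * p_pol (c k)
  else (p_pol (c k) - 'X * p_pol (c k).-1) * p_pol (k - c k).+1.

Definition z_walk (c : walk) (k : nat) : Zx :=
  \sum_(0 <= i < k.+1) 'X ^+ i * r_walk c (k - i).

(* The value of r at a step up (resp. down) that starts at coordinate a and
   height h. *)
Definition r_up a h : Zx := - (p_pol (a + h) * p_pol a).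
Definition r_dn a h : Zx := (p_pol a.+1 - 'X * p_pol a) * p_pol (a + h).+1.

(** This nonzero difference separates the two continuations of a walk, and it is the common
    denominator of [w_up h] and [w_dn h]. *)
Lemma r_dnB_r_up a h : r_dn a h - r_up a h = p_pol h.+1.
Proof. by rewrite [RHS](p_pol_subn _ a) /r_dn /r_up addnS p_polSS; ring. Qed.

(** For a valley over height h.+1 this is r(k+1) + z(k-1), minus the numerator of [w_dn h.+1]. The
    next lemma is the analogue at a peak over height h. *)
Lemma r_up_valley a h :
  r_up a.+1 h + p_pol a * p_pol (a + h.+1).+1 = - p_pol h.+1.
Proof. by rewrite [in RHS](p_pol_subn _ a) /r_up addSnnS; ring. Qed.

Lemma r_dn_peak a h : r_dn a h.+1 + p_pol a * p_pol (a + h).+1 = p_pol h.+2.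
Proof. by rewrite [RHS](p_pol_subn _ a) /r_dn !addnS !p_polSS; ring. Qed.

(** With k = 2a + h + 1 the right-hand side is p_k - x z(k-1). Subtracting 2 r(k) thus leaves, up to
    sign, the difference of the two values of r in the block. *)
Lemma r_upD_r_dn a h :
  r_up a h + r_dn a h = p_pol (a.*2 + h).+1 - 'X * (p_pol a * p_pol (a + h).+1).
Proof. by rewrite -addnn -addnA p_pol_addn /r_up /r_dn; ring. Qed.

Lemma r_up_straight a h : r_up a h.+1 = - (p_pol a * p_pol (a + h).+1).
Proof. by rewrite /r_up addnS mulrC. Qed.

Lemma r_dn_straight a h : r_dn a.+1 h = - (p_pol a * p_pol (a + h.+1).+1).
Proof. by rewrite /r_dn p_polSS addSnnS; ring. Qed.

Lemma eq_r_walk c d k : c k.-1 = d k.-1 -> c k = d k -> r_walk c k = r_walk d k.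
Proof. by rewrite /r_walk => -> ->. Qed.

Lemma z_walkS c k : z_walk c k.+1 = r_walk c k.+1 + 'X * z_walk c k.
Proof.
rewrite /z_walk big_nat_recl // expr0 mul1r subn0 mulr_sumr; congr (_ + _).
by apply: eq_bigr => i _; rewrite subSS exprS mulrA.
Qed.

Section WalkEigenvalues.

Variables n f : nat.
Local Notation is_walk := (is_walk n f).
Local Notation act := (tl_act (walk_module n f)).

Section RWalk.

Variables (c : walk) (k : nat).
Hypotheses (pc : is_walk c) (kn : (k < n)%N).

Let hk : ((c k).*2 <= k)%N.
Proof. by apply: (walk_half pc); lia. Qed.

Lemma r_walk_up : c k.+1 = c k -> r_walk c k.+1 = r_up (c k) (ht c k).
Proof.
move=> e; rewrite /r_walk -[k.+1.-1]/k e eqxx /r_up /ht.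
(* The convention r(1) = 0 agrees with the formula because p_0 = 0. *)
have [k0|k0] := posnP k; first by rewrite k0 (walk0 pc) p_pol0 !mulr0 oppr0.
rewrite ifF; last by lia.
rewrite (_ : (k.+1 - c k = (k - c k).+1)%N); last by lia.
rewrite (_ : (c k + (k - (c k).*2) = k - c k)%N); last by lia.
rewrite p_polSS; ring.
Qed.

Lemma r_walk_dn : c k.+1 = (c k).+1 -> r_walk c k.+1 = r_dn (c k) (ht c k).
Proof.
move=> e; have := walk_half pc (k := k.+1) kn; rewrite e => h2.
rewrite /r_walk -[k.+1.-1]/k e ifF; last by lia.
rewrite ifF /=; last by apply/eqP; lia.
by rewrite /r_dn /ht (_ : (k.+1 - (c k).+1 = c k + (k - (c k).*2))%N) //; lia.
Qed.

End RWalk.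

(** In z(k+1) = r(k+1) + x z(k), a step up completes the Chebyshev recurrence in the second factor,
    and a step down cancels the x term against that of r. *)
Lemma z_walkE c k : is_walk c -> (k <= n)%N ->
  z_walk c k = p_pol (c k) * p_pol (c k + ht c k).+1.
Proof.
move=> pc; elim: k => [|k IH] kn.
  by rewrite /z_walk big_nat1 /r_walk /= (walk0 pc) p_pol0 mulr0 mul0r.
have hk : ((c k).*2 <= k)%N by apply: (walk_half pc); lia.
rewrite z_walkS (IH (ltnW kn)); case: (walk_step pc kn) => e.
  rewrite r_walk_up // e /r_up (_ : ht c k.+1 = (ht c k).+1); last first.
    by rewrite /ht e; lia.
  by rewrite addnS [X in _ = _ * X]p_polSS; ring.
have := walk_half pc (k := k.+1) kn; rewrite e => h2.
rewrite r_walk_dn // /r_dn addSnnS (_ : (ht c k.+1).+1 = ht c k); first by ring.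
by rewrite /ht e; lia.
Qed.

(** Where c does not turn at k, every term of [T_next] that contains e_k vanishes at c, and only
    -z_(k-1) is left. *)
Lemma r_walk_straight c k : is_walk c -> (0 < k < n)%N -> ~~ turns n f k c ->
  r_walk c k.+1 = - z_walk c k.-1.
Proof.
case: k => [//|k] pc /= kn tc; have kn' : (k < n)%N by lia.
have hk : ((c k).*2 <= k)%N by apply: (walk_half pc); lia.
have hk2 := walk_half pc kn.
rewrite z_walkE //; last by lia.
case: (walk_step pc kn') (walk_step pc kn) => e1 [] e2.
- rewrite r_walk_up // e1 (_ : ht c k.+1 = (ht c k).+1); last first.
    by rewrite /ht e1; lia.
  exact: r_up_straight.
- by case/turnsP: tc; rewrite /= e2 e1.
- by case/turnsP: tc; rewrite /= e2 e1.
- rewrite r_walk_dn // e1 r_dn_straight (_ : (ht c k.+1).+1 = ht c k) //.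
  by move: hk2; rewrite /ht e2 e1; lia.
Qed.

Section Turn.

Variables (c : walk) (k : nat).
Hypotheses (kn : (0 < k < n)%N) (tc : turns n f k c).
Let a := c k.-1.
Let h := ht c k.-1.

Let pc : is_walk c. Proof. by case/turnsP: tc. Qed.
Let ck : c k.+1 = a.+1. Proof. by case/turnsP: tc. Qed.
Let km : (k.-1 < n)%N. Proof. by lia. Qed.
Let ek : k.-1.+1 = k. Proof. by lia. Qed.
Let ha : (a.*2 <= k.-1)%N.
Proof. by apply: (walk_half pc); lia. Qed.

Lemma turn_valley_ht : c k = a.+1 -> (0 < h)%N.
Proof.
move=> e; have kn' : (k <= n)%N by lia.
by have := walk_half pc kn'; rewrite e /h /ht -/a; lia.
Qed.

Lemma r_walk_peak : c k = a -> r_walk c k = r_up a h.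
Proof. by move=> e; have := r_walk_up pc km; rewrite ek => ->. Qed.

Lemma r_walk_valley : c k = a.+1 -> r_walk c k = r_dn a h.
Proof. by move=> e; have := r_walk_dn pc km; rewrite ek => ->. Qed.

Lemma r_walk_peakS : c k = a -> r_walk c k.+1 + z_walk c k.-1 = p_pol h.+2.
Proof.
move=> e; rewrite z_walkE ?(ltnW km) // r_walk_dn; [|by []|by lia|by rewrite ck e].
rewrite e -/a (_ : ht c k = h.+1) ?r_dn_peak //.
by rewrite /h /ht e -/a; lia.
Qed.

Lemma r_walk_valleyS : c k = a.+1 -> r_walk c k.+1 + z_walk c k.-1 = - p_pol h.
Proof.
move=> e; have h0 := turn_valley_ht e.
rewrite z_walkE ?(ltnW km) // r_walk_up; [|by []|by lia|by rewrite ck e].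
have eh : (ht c k).+1 = h by move: h0; rewrite /h /ht e -/a; lia.
by rewrite e -/a -/h -eh r_up_valley.
Qed.

Lemma turn_denominator :
  p_pol k - 'X * z_walk c k.-1 = r_up a h + r_dn a h.
Proof.
rewrite z_walkE ?(ltnW km) // r_upD_r_dn (_ : (_ + h).+1 = k) //.
by rewrite /h /ht -/a; lia.
Qed.

Lemma w_dn_turn : c k = a.+1 ->
  w_dn h = (r_walk c k.+1 + z_walk c k.-1)%:F /
           (p_pol k - 'X * z_walk c k.-1 - r_walk c k *+ 2)%:F.
Proof.
move=> e; rewrite r_walk_valleyS // turn_denominator r_walk_valley //.
rewrite (_ : _ - _ = - p_pol h.+1); last by rewrite -(r_dnB_r_up a); ring.
by rewrite !tofracN invrN mulrNN.
Qed.

Lemma w_up_turn : c k = a ->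
  w_up h = (r_walk c k.+1 + z_walk c k.-1)%:F /
           (p_pol k - 'X * z_walk c k.-1 - r_walk c k *+ 2)%:F.
Proof.
move=> e; rewrite r_walk_peakS // turn_denominator r_walk_peak //.
by rewrite (_ : _ - _ = p_pol h.+1) // -(r_dnB_r_up a); ring.
Qed.

End Turn.

Lemma walk_actE psi k : (0 < k < n)%N -> act psi (tl_e n k) = walk_gen n f k psi.
Proof. exact: tl_act_e. Qed.

Lemma walk_act_z psi c k :
  (forall j, (j <= k)%N -> act psi (T_elt n j) c = (r_walk c j)%:F * psi c) ->
  act psi (z_elt (T_elt n) k) c = (z_walk c k)%:F * psi c.
Proof.
move=> IH; rewrite /z_elt; case: ltnP => k2.
  rewrite tl_act0 /z_walk big_nat big1 ?tofrac0 ?mul0r // => i _.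
  by rewrite /r_walk ifT ?mulr0 // (leq_ltn_trans _ k2) // leq_subr.
rewrite tl_act_sum fct_sumE /z_walk rmorph_sum mulr_suml.
apply: eq_bigr => i _; rewrite tl_actZ rmorphM -mulrA -IH ?leq_subr //.
Qed.

End WalkEigenvalues.

(** * Diagonal action of the elements T_k *)

Section TEigenvalues.

Variables n f : nat.
Local Notation act := (tl_act (walk_module n f)).

Lemma p_frac_w_up h : p_frac h.+1 * w_up h = p_frac h.+2.
Proof. by rewrite /w_up mulrC divfK // p_frac_neq0. Qed.

Lemma p_frac_w_dn h : p_frac h.+1 * w_dn h = p_frac h.
Proof. by rewrite /w_dn mulrC divfK // p_frac_neq0. Qed.

Section NextT.

Variables (c : walk) (k : nat).
Hypotheses (kn : (1 < k < n)%N) (tc : turns n f k c).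
Hypothesis T_k_act : forall phi d, is_walk n f d ->
  act phi (T_elt n k) d = (r_walk d k)%:F * phi d.

Let a := c k.-1.
Let h := ht c k.-1.
Let kn' : (0 < k < n)%N. Proof. by lia. Qed.
Let pc : is_walk n f c. Proof. by case/turnsP: tc. Qed.

Lemma walk_gen_T_k phi : walk_gen n f k (act phi (T_elt n k)) c =
  w_up h * ((r_up a h)%:F * phi (upd c k a)) +
  w_dn h * ((r_dn a h)%:F * phi (upd c k a.+1)).
Proof.
have [t1 t2] := turns_upd kn' tc; case/turnsP: (t1) => [p1 _].
have k1 : k.-1 != k by lia.
rewrite {1}/walk_gen tc -/a -/h T_k_act // (r_walk_peak kn' t1); last first.
  by rewrite updE upd_neq.
rewrite ht_upd // upd_neq // -/a -/h.
have [h0|hp] := posnP h; first by rewrite h0 w_dn0 !mul0r.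
have t3 := t2 hp; case/turnsP: (t3) => [p2 _].
rewrite T_k_act // (r_walk_valley kn' t3); last by rewrite updE upd_neq.
by rewrite ht_upd // upd_neq.
Qed.

(** Only the member of the block that turns at k.-1 contributes, with its own value of r. The other
    one goes straight through k.-1, so its value is -z(k-2); adding it together with z(k-2) merges
    both cases into one formula. *)
Lemma walk_gen_braid_T_k psi :
  walk_gen n f k (act (walk_gen n f k.-1 (walk_gen n f k psi)) (T_elt n k)) c =
  ((r_up a h + r_dn a h)%:F + (z_walk c k.-2)%:F) * walk_gen n f k psi c.
Proof.
have [k1 kn1] : (1 < k)%N /\ (k < n)%N by lia.
have [t1 t2] := turns_upd kn' tc.
have k2n : (k.-2 < n)%N by lia.
have step2 := walk_step pc k2n.
rewrite (_ : k.-2.+1 = k.-1) in step2; last by lia.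
have hk : ((c k.-1).*2 <= k.-1)%N by apply: (walk_half pc); lia.
have hk2 : ((c k.-2).*2 <= k.-2)%N by apply: (walk_half pc); lia.
rewrite walk_gen_T_k walk_gen_pred_upd // -/a (z_walkE pc); last by lia.
have -> : w_dn h * ((r_dn a h)%:F *
      walk_gen n f k.-1 (walk_gen n f k psi) (upd c k a.+1)) =
    w_dn h * ((r_dn a h)%:F *
      ((if a == c k.-2 then w_up (ht c k.-2) else 0) * walk_gen n f k psi c)).
  have [h0|hp] := posnP h; first by rewrite h0 w_dn0 !mul0r.
  rewrite walk_gen_pred_upd //; last exact: t2.
  by rewrite eqSS -/a; case: eqP.
rewrite -tofracD; case: step2 => e; rewrite -/a in e hk; rewrite e.
  rewrite eqxx ifF; last by apply/eqP; lia.
  have eh : h = (ht c k.-2).+1 by rewrite /h /ht -/a; lia.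
  rewrite !mul0r !mulr0 add0r mulrCA (mulrA (w_dn h)) eh w_dn_up mul1r.
  by rewrite r_up_straight; congr (_%:F * _); ring.
rewrite eqxx !ifF; [|by apply/eqP; lia..].
have eh : ht c k.-2 = h.+1 by rewrite /h /ht -/a; lia.
rewrite mul0r !mulr0 addr0 mulrCA (mulrA (w_up h)) eh w_up_dn mul1r.
by rewrite r_dn_straight; congr (_%:F * _); ring.
Qed.

End NextT.

Lemma act_T_next psi c k : is_walk n f c -> (1 < k < n)%N ->
  (forall phi d j, is_walk n f d -> (j <= k)%N ->
     act phi (T_elt n j) d = (r_walk d j)%:F * phi d) ->
  act psi (T_next k (T_elt n)) c = (r_walk c k.+1)%:F * psi c.
Proof.
move=> pc kn IH; have kn' : (0 < k < n)%N by lia.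
have Z phi j : (j <= k)%N ->
    act phi (z_elt (T_elt n) j) c = (z_walk c j)%:F * phi c.
  by move=> jk; apply: walk_act_z => i ij; apply: IH => //; lia.
rewrite /T_next mulNr !(tl_actB, tl_actD, tl_actN, tl_actM) !walk_actE //; try lia.
rewrite !fctE !Z; [|by lia..]; rewrite (IH _ c k) //.
have [tc|tc] := boolP (turns n f k c); last first.
  rewrite !walk_gen_out // !mulr0 (r_walk_straight pc kn' tc) tofracN mulNr.
  by rewrite oppr0 !(add0r, addr0).
have Tk phi d (pd : is_walk n f d) := IH phi d k pd (leqnn k).
rewrite walk_gen_braid_T_k // walk_gen_T_k // {1 2 3}/walk_gen tc.
set a := c k.-1; set h := ht c k.-1.
have rB : (r_dn a h)%:F = p_frac h.+1 + (r_up a h)%:F.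
  by rewrite -tofracD -(r_dnB_r_up a) subrK.
have up := p_frac_w_up h; have dn := p_frac_w_dn h.
have km : (k.-1 < n)%N by lia.
have ek : k.-1.+1 = k by lia.
(* Collected, the coefficient of e_k psi is r_up + r_dn - r(k), the value of r at the other member
   of the block. Hence the off-diagonal terms cancel, and e_k contributes p_(h+1) [w_up h] = p_(h+2)
   at a peak and -p_(h+1) [w_dn h] = -p_h at a valley. *)
case: (walk_step pc km); rewrite ek => e.
  have := r_walk_peakS kn' tc e; rewrite -/h => /(congr1 (@FracField.tofrac _)).
  rewrite tofracD => /(canRL (addrK _)) ->.
  rewrite (r_walk_peak kn' tc e) -/a -/h -up (upd_id (v := a)) // tofracD rB.
  move: (w_up h) (w_dn h) (p_frac h.+1) (r_up a h)%:F => *; ring.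
have := r_walk_valleyS kn' tc e; rewrite -/h => /(congr1 (@FracField.tofrac _)).
rewrite tofracD tofracN => /(canRL (addrK _)) ->.
rewrite (r_walk_valley kn' tc e) -/a -/h -dn (upd_id (v := a.+1)) // tofracD rB.
move: (w_up h) (w_dn h) (p_frac h.+1) (r_up a h)%:F => *; ring.
Qed.

Lemma act_T_elt psi c k : is_walk n f c -> (k <= n)%N ->
  act psi (T_elt n k) c = (r_walk c k)%:F * psi c.
Proof.
elim/ltn_ind: k psi c => -[|[|[|k]]] IH psi c pc kn.
- by rewrite tl_act0 tofrac0 mul0r.
- by rewrite tl_act0 tofrac0 mul0r.
(* e_1 is diagonal already: every block at place 1 lies over height 0 and has a single walk. *)
- rewrite (_ : T_elt n 2 = tl_e n 1) // walk_actE //.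
  have c0 := walk0 pc; have c1 := walk_half pc (ltnW kn).
  have {}c1 : c 1%N = 0%N by lia.
  have kn' : (1 < n)%N := kn.
  rewrite /walk_gen /r_walk /= c1; case: ifP => [/turnsP [_ /= ->] | tc].
    rewrite c0 /ht c0 /= w_dn0 mul0r addr0 upd_id // -[w_up 0]addr0 -w_dn0.
    by rewrite w_upD_w_dn p_pol0 p_pol1 mulr0 subr0 mul1r p_polSS p_pol1 p_pol0 mulr1 subr0.
  case: (walk_step pc kn') => e; last first.
    by move/turnsP: tc; case; split; rewrite //= c0 e c1.
  by rewrite e c1 eqxx p_pol0 mulr0 tofrac0 mul0r.
- rewrite T_elt_rec //; apply: act_T_next => //.
  by move=> phi d j pd jk; apply: IH => //; lia.
Qed.

End TEigenvalues.

Lemma is_walk_mono n f c k l : is_walk n f c -> (k <= l <= n)%N -> (c k <= c l)%N.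
Proof.
move=> pc /andP [kl ln]; elim: l kl ln => [|l IH] kl ln; first by case: k kl.
move: kl; rewrite leq_eqVlt => /orP [/eqP -> // | kl].
by have := IH kl (ltnW ln); case: (walk_step pc ln) => ->; lia.
Qed.

(** * Vanishing of the higher ideals, the lowest walk, and triangularity *)

Section Support.

Variables n f : nat.
Local Notation act := (tl_act (walk_module n f)).

Lemma walk_gen_neq0 k psi c : (0 < k < n)%N -> walk_gen n f k psi c != 0 ->
  turns n f k c /\ exists v, turns n f k (upd c k v) /\ psi (upd c k v) != 0.
Proof.
move=> kn; have [tc|tc] := boolP (turns n f k c); last first.
  by rewrite walk_gen_out ?eqxx.
have [t1 t2] := turns_upd kn tc; rewrite /walk_gen tc.
have [->|nz1] := eqVneq (psi (upd c k (c k.-1))) 0; last first.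
  by move=> _; split=> //; exists (c k.-1).
have [h0|hp] := posnP (ht c k.-1).
  by rewrite h0 w_dn0 mul0r mulr0 addr0 eqxx.
rewrite mulr0 add0r mulf_eq0 negb_or => /andP [_ nz].
by split=> //; exists (c k.-1).+1; split=> //; exact: t2.
Qed.

(** The last factor forces a turn at 2j-1, so the height at 2j equals that at 2j-2, which is 0 by
    induction; changing the walk at 2j-1 affects neither place. *)
Lemma act_odd_prod_neq0 psi j c : (j.*2 <= n)%N -> is_walk n f c ->
  act psi (\prod_(0 <= i < j) tl_e n i.*2.+1) c != 0 -> c j.*2 = j.
Proof.
elim: j c => [|j IH] c jn pc; first by rewrite (walk0 pc).
have jn' : (0 < j.*2.+1 < n)%N by lia.
rewrite big_nat_recr //= tl_actM walk_actE // => /(walk_gen_neq0 jn').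
move=> [/turnsP [_ /= ck] [v [/turnsP [pv _] /IH]]].
by rewrite upd_neq; [rewrite doubleS ck => -> //; lia | lia].
Qed.

(** A walk in the support would have made mu.1 steps down by place 2 mu.1, but it makes only f <
    mu.1 in all. *)
Lemma act_m_elt_eq0 psi mu : is_part n mu -> (f < mu.1)%N ->
  act psi (m_elt n mu) = 0.
Proof.
move=> /eqP mun fmu; apply/funext => c; apply/eqP; apply: contraTT isT => nz.
have pc : is_walk n f c.
  move: nz; rewrite /m_elt; case: (mu.1) mun fmu => // j mun _.
  rewrite big_nat_recr //= tl_actM walk_actE; last by lia.
  by move/walk_gen_neq0 => -[|/turnsP []//]; lia.
have j2 : (mu.1.*2 <= n)%N by lia.
have := act_odd_prod_neq0 j2 pc nz; have := walk_end pc.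
have := is_walk_mono (k := mu.1.*2) (l := n) pc; rewrite leqnn andbT => /(_ j2).
lia.
Qed.

Lemma act_check_ideal la psi a : f = la.1 -> is_part n la ->
  a \in check_ideal n la -> act psi a = 0.
Proof.
move=> fE /eqP lan /asboolP [g [gI ->]]; rewrite tl_act_sum big_seq_cond big1 //.
move=> mu /andP []; rewrite mem_parts => mun /andP [dom ne].
have fmu : (f < mu.1)%N.
  rewrite fE ltn_neqAle [X in _ && X]dom andbT; apply: contra ne => /eqP e.
  move: mun lan e; rewrite /is_part; case: (mu) => x y; case: (la) => z w /=.
  by move=> /eqP h1 h2 h3; apply/eqP; congr (_, _); lia.
case: (gI mu) => u ->; rewrite tl_act_sum big1 // => p _.
by rewrite !tl_actM act_m_elt_eq0 // tl_act0l.
Qed.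

(** Heights alternate between 0 and 1 until f steps down are made, then only increase. *)
Definition low_walk : walk := fun l => if (l <= n)%N then minn l./2 f else 0%N.

Lemma is_walk_low : (f.*2 <= n)%N -> is_walk n f low_walk.
Proof.
by move=> fn; split=> [|k kn|k kn||k kn]; rewrite /low_walk; do ?case: ifP; lia.
Qed.

Definition low_vect : walk -> Zx_frac^o := fun c => if `[< c = low_walk >] then 1 else 0.

(** The lowest walk has height 0 at 2i, so its block at 2i+1 is one-dimensional with entry [w_up 0]
    = x. *)
Lemma walk_gen_low i : (f.*2 <= n)%N -> (i < f)%N ->
  walk_gen n f i.*2.+1 low_vect = 'X%:F *: low_vect.
Proof.
move=> fn ifn; have kn : (0 < i.*2.+1 < n)%N by lia.
apply/funext => c; rewrite /GRing.scale /= {2}/low_vect.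
have tl : turns n f i.*2.+1 low_walk.
  apply/turnsP; split; first exact: is_walk_low.
  by rewrite /low_walk /=; do ?case: ifP; lia.
have [->|nc] := asboolP (c = low_walk).
  have lE : low_walk i.*2 = i by rewrite /low_walk; case: ifP; lia.
  rewrite /walk_gen tl /= /ht lE subnn w_dn0 mul0r addr0 upd_id; last first.
    by rewrite /low_walk; case: ifP; lia.
  rewrite /low_vect asboolT // !mulr1.
  by rewrite -[w_up 0]addr0 -w_dn0 w_upD_w_dn [RHS]mulr1.
apply/eqP; rewrite scaler0; apply: contraT => /(walk_gen_neq0 kn).
move=> [/turnsP [pc _] [v [tv]]]; rewrite /low_vect.
case: asboolP; rewrite ?eqxx // => e _; case: nc.
apply/funext => l; have eE j : upd c i.*2.+1 v j = low_walk j by rewrite e.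
have [->|lk] := eqVneq l i.*2.+1; last by rewrite -eE upd_neq.
have := eE i.*2; rewrite upd_neq; last by lia.
have h2 : (i.*2 < n)%N by lia.
have := walk_step pc h2; have := walk_half pc (k := i.*2.+1).
by rewrite /low_walk; do ?case: ifP; lia.
Qed.

Lemma act_m_elt_low la : f = la.1 -> (f.*2 <= n)%N ->
  act low_vect (m_elt n la) = 'X%:F ^+ f *: low_vect.
Proof.
move=> fE fn; rewrite /m_elt -fE.
suff prod_low j : (j <= f)%N ->
    act low_vect (\prod_(0 <= i < j) tl_e n i.*2.+1) = 'X%:F ^+ j *: low_vect.
  exact: prod_low.
elim: j => [|j IH] jf; first by rewrite big_geq // tl_act1 scale1r.
rewrite big_nat_recr //= tl_actM IH; last by lia.
rewrite tl_actZl walk_actE; last by lia.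
by rewrite walk_gen_low // scalerA exprSr.
Qed.

(* The f-basis vector of t is, up to a common factor, the indicator of t times
   this weight; each step down from height h contributes 1 / p_h. *)
Definition walk_weight (c : walk) : Zx_frac :=
  \prod_(l < n) if c l.+1 == c l then 1 else (p_frac (ht c l))^-1.

Lemma walk_weight_neq0 c : is_walk n f c -> walk_weight c != 0.
Proof.
move=> pc; apply/prodf_neq0 => l _; case: ifP => [_|/eqP ne]; first by rewrite oner_eq0.
have := walk_half pc (ltn_ord l).
case: (walk_step pc (ltn_ord l)) => // -> h2.
rewrite invr_eq0 (_ : ht c l = (ht c l).-1.+1) ?p_frac_neq0 //.
by rewrite /ht; lia.
Qed.

(** Flipping a valley over height h into a peak moves its step down from height h to h+1, which
    replaces 1/p_h by 1/p_(h+1). The ratio is the coefficient that e_k puts on the valley. *)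
Lemma walk_weight_flip c k : (0 < k < n)%N -> is_walk n f c ->
  c k = (c k.-1).+1 -> c k.+1 = (c k.-1).+1 ->
  walk_weight (upd c k (c k.-1)) = w_dn (ht c k.-1) * walk_weight c.
Proof.
move=> kn pc ck ckS; have kn' : (k < n)%N by lia.
have km : (k.-1 < n)%N by lia.
have ek : k.-1.+1 = k by lia.
have split2 (G : 'I_n -> Zx_frac) : \prod_l G l = G (Ordinal km) *
    (G (Ordinal kn') * \prod_(l | (l != Ordinal km) && (l != Ordinal kn')) G l).
  rewrite (bigD1 (Ordinal km)) // [X in _ * X = _](bigD1 (Ordinal kn')) //.
  by rewrite -val_eqE /=; lia.
rewrite /walk_weight !split2 /=.
have nk : k.+1 != k by lia.
have nk1 : k.-1 != k by lia.
rewrite ek !updE !upd_neq // /ht !updE ckS ck !eqxx.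
rewrite (_ : _ == c k.-1 = false); last by apply/eqP; lia.
rewrite (_ : (k - (c k.-1).*2 = (k.-1 - (c k.-1).*2).+1)%N); last first.
  by have := walk_half pc (ltnW kn'); rewrite ck; lia.
rewrite !mul1r mulrA /w_dn; congr (_ * _).
  rewrite mulrAC divff ?mul1r //.
  have := walk_half pc (ltnW kn'); rewrite ck => h2.
  rewrite (_ : (k.-1 - (c k.-1).*2 = (k.-1 - (c k.-1).*2).-1.+1)%N); last by lia.
  exact: p_frac_neq0.
apply: eq_bigr => l; rewrite -!val_eqE /= => /andP [l1 l2].
by rewrite !upd_neq //; lia.
Qed.

(* Pointwise larger walks have smaller heights: u is the highest walk in the
   support of psi. *)
Definition leads (C : Zx_frac) (psi : walk -> Zx_frac^o) (u : walk) : Prop :=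
  [/\ is_walk n f u, psi u = C * walk_weight u &
      forall c, is_walk n f c -> psi c != 0 -> forall l, (u l <= c l)%N].

(** psi vanishes at the flipped walk, which is strictly higher than u at k. The new leading value is
    therefore [w_dn] times psi u, as [walk_weight_flip] requires. *)
Lemma leads_flip C psi u k : (0 < k < n)%N ->
  u k = (u k.-1).+1 -> u k.+1 = (u k.-1).+1 -> leads C psi u ->
  leads C (walk_gen n f k psi) (upd u k (u k.-1)).
Proof.
move=> kn uk ukS [pu psiu supp].
have kn' : (k < n)%N by lia.
have km : (k.-1 < n)%N by lia.
have hm := walk_half pu (ltnW km).
have tu : turns n f k u by apply/turnsP.
have [t1 t2] := turns_upd kn tu; have [p1 _] := turnsP _ _ _ _ t1.
split; first exact: p1.
  rewrite walk_gen_upd //; last by lia.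
  rewrite /walk_gen tu (upd_id (v := (u k.-1).+1)) // psiu walk_weight_flip //.
  have [->|/supp] := eqVneq (psi (upd u k (u k.-1))) 0.
    by rewrite mulr0 add0r mulrCA.
  by move=> /(_ p1 k); rewrite updE uk ltnn.
move=> c pc /(walk_gen_neq0 kn) [/turnsP [_ ck] [v [/turnsP [pv _] /supp]]].
move=> /(_ pv) le l; have [->|lk] := eqVneq l k; last first.
  by have := le l; rewrite !upd_neq.
rewrite updE; have := le k.-1; rewrite upd_neq; last by lia.
by move=> h; apply: leq_trans h _; apply: (is_walk_mono pc); lia.
Qed.

(** With i = c k this interpolates between [low_walk] at k = n and c itself at k = 0. *)
Definition low_below (c : walk) (k i : nat) : walk :=
  fun l => if (l < k)%N then minn l./2 i else c l.

(* Starting from the lowest walk below k, the factor of v_elt for a step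
   down flips the valleys at 2 (c k.+1), ..., k from left to right. *)
Lemma leads_w_elt C psi c k : is_walk n f c -> (k < n)%N -> c k.+1 = (c k).+1 ->
  leads C psi (low_below c k.+1 (c k.+1)) ->
  leads C (act psi (w_elt n (c k.+1).*2 k.+1)) (low_below c k (c k)).
Proof.
move=> pc kn e lead0; have h2 := walk_half pc (k := k.+1) kn.
have wE : w_elt n (c k.+1).*2 k.+1 = \prod_((c k.+1).*2 <= l < k.+1) tl_e n l.
  rewrite /w_elt; case: ltngtP h2 => // -> _; by rewrite big_geq.
(* In [u j] the last step down of the low part is delayed to the step from j.-1 to j; it is in its
   original place for j = 2 (c k.+1). *)
pose u j : walk := fun l => if (l < j)%N then minn l./2 (c k)
  else low_below c k.+1 (c k.+1) l.
have uE : u k.+1 = low_below c k (c k).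
  apply/funext => l; rewrite /u /low_below.
  by have [->|lk] := eqVneq l k; do ?case: ifP; lia.
rewrite wE -uE.
suff: forall j, ((c k.+1).*2 <= j <= k.+1)%N ->
    leads C (act psi (\prod_((c k.+1).*2 <= l < j) tl_e n l)) (u j).
  by apply; rewrite h2 leqnn.
elim=> [|j IH] hj; first by lia.
have [jc|jc] := eqVneq j.+1 (c k.+1).*2.
  have uj : u (c k.+1).*2 = low_below c k.+1 (c k.+1).
    by apply/funext => l; rewrite /u /low_below; do ?case: ifP; lia.
  rewrite jc big_geq; last exact: leqnn.
  by rewrite tl_act1 uj; exact: lead0.
rewrite big_nat_recr /=; last by lia.
rewrite tl_actM walk_actE; last by lia.
have uj : u j j = (u j j.-1).+1.
  by rewrite /u /low_below; do ?case: ifP; lia.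
have ujS : u j j.+1 = (u j j.-1).+1.
  rewrite /u /low_below.
  by have [->|jk] := eqVneq j k; do ?case: ifP; lia.
have ujE : u j.+1 = upd (u j) j (u j j.-1).
  apply/funext => l; rewrite /upd; case: eqP => [->|lj].
    by rewrite /u /low_below; do ?case: ifP; lia.
  by rewrite /u; do ?case: ifP => //; lia.
rewrite ujE; apply: leads_flip uj ujS _; first by lia.
by apply: IH; lia.
Qed.

(** In a right action [w_elt] acts before the remaining factor of [v_elt], so the walk c is built
    from its end and the low part shrinks with k. *)
Lemma leads_v_elt C s c k psi : is_walk n f c -> (k <= n)%N ->
  (forall l, (l <= n)%N -> (Defs.shape s l).1 = c l) ->
  leads C psi (low_below c k (c k)) -> leads C (act psi (v_elt n s k)) c.
Proof.
move=> pc kn sc; elim: k kn psi => [|k IH] kn psi lead0.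
  by rewrite /= tl_act1; move: lead0; rewrite (_ : low_below c 0 _ = c).
have vE : v_elt n s k.+1 = if c k == c k.+1 then v_elt n s k
    else w_elt n (c k.+1).*2 k.+1 * v_elt n s k.
  by rewrite -(sc k (ltnW kn)) -(sc k.+1 kn).
rewrite vE; case: eqP => [e|ne].
  apply: IH (ltnW kn) _ _.
  suff <- : low_below c k.+1 (c k.+1) = low_below c k (c k) by [].
  apply/funext => l; rewrite /low_below -e; have := walk_half pc (ltnW kn).
  by have [->|lk] := eqVneq l k; do ?case: ifP; lia.
have e : c k.+1 = (c k).+1 by case: (walk_step pc kn) => // e; case: ne.
rewrite tl_actM; apply: IH (ltnW kn) _ _.
exact: leads_w_elt lead0.
Qed.

(** The constant depends on n and f only, so it is common to all f_t and cancels from the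
    coefficients of e_k. *)
Lemma leads_low la : f = la.1 -> (f.*2 <= n)%N ->
  leads ('X%:F ^+ f / walk_weight low_walk) (act low_vect (m_elt n la)) low_walk.
Proof.
move=> fE fn; have pl := is_walk_low fn; rewrite act_m_elt_low //; split=> //.
  rewrite divfK; last exact: walk_weight_neq0 pl.
  by rewrite -[LHS]/('X%:F ^+ f * low_vect low_walk) /low_vect asboolT // mulr1.
move=> c _; rewrite -[X in X != _]/('X%:F ^+ f * low_vect c) /low_vect.
by case: asboolP => [-> //|_]; rewrite mulr0 eqxx.
Qed.

Lemma low_below_end c : is_walk n f c -> low_below c n (c n) = low_walk.
Proof.
move=> pc; apply/funext => l; rewrite /low_below /low_walk (walk_end pc).
have := walk_half pc (leqnn n); rewrite (walk_end pc) => h.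
case: ltngtP => [ln|nl|->].
- by [].
- exact: walk_out pc _ nl.
- by rewrite (walk_end pc); lia.
Qed.

End Support.

(** * Tableaux as walks *)

Definition tab_walk (s : seq (nat * nat)) : walk := fun k => (Defs.shape s k).1.

Lemma r_tabE s k : r_tab s k = r_walk (tab_walk s) k.
Proof. by []. Qed.

Section TableauxAsWalks.

Variables (n : nat) (la : nat * nat).

Lemma shape_tab (t : tab n la) k : (k <= n)%N ->
  Defs.shape t k = (tab_walk t k, ht (tab_walk t) k).
Proof.
move=> kn; case/and5P: (tab_valP t) => _ /forallP /(_ (Ordinal (kn : (k < n.+1)%N))).
rewrite /is_part /= /ht /tab_walk; case: (Defs.shape t k) => a b /= /eqP e _ _ _.
by congr (_, _); lia.
Qed.

Lemma is_walk_tab (t : tab n la) : is_walk n la.1 (tab_walk t).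
Proof.
case/and5P: (tab_valP t) => /eqP sz /forallP hp /eqP s0 /forallP ha /eqP sn.
split.
- by rewrite /tab_walk s0.
- move=> k kn; have := ha (Ordinal kn); rewrite /arrow /tab_walk /=.
  case: (Defs.shape t k) => a b; case: (Defs.shape t k.+1) => a' b' /=.
  by case/orP => /eqP [-> *]; [left | right].
- move=> k kn; have := hp (Ordinal (kn : (k < n.+1)%N)).
  by rewrite /is_part /tab_walk /= => /eqP; lia.
- by rewrite /tab_walk sn.
- by move=> k kn; rewrite /tab_walk /Defs.shape nth_default // sz.
Qed.

Lemma tab_walk_inj : injective (fun t : tab n la => tab_walk t).
Proof.
move=> s t /= st; apply: tab_val_inj.
case/and5P: (tab_valP s) (tab_valP t) => /eqP ss _ _ _ _ /and5P [/eqP ts _ _ _ _].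
apply: (@eq_from_nth _ (0%N, 0%N)); first by rewrite ss ts.
move=> k; rewrite ss ltnS => kn.
by rewrite -[LHS]/(Defs.shape s k) -[RHS]/(Defs.shape t k) !shape_tab // st.
Qed.

Lemma walk_tab f (c : walk) k : is_walk n f c -> (k <= n)%N ->
  exists t : tab k (c k, ht c k), forall l, (l <= k)%N -> tab_walk t l = c l.
Proof.
move=> pc kn; pose s := mkseq (fun l => (c l, ht c l)) k.+1.
have sE l : (l <= k)%N -> Defs.shape s l = (c l, ht c l).
  by move=> lk; rewrite /Defs.shape nth_mkseq.
have hc l : (l <= k)%N -> ((c l).*2 <= l)%N.
  by move=> lk; apply: (walk_half pc); lia.
have /tab_surj [t ts] : is_tab k (c k, ht c k) s; last first.
  by exists t => l lk; rewrite /tab_walk ts sE.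
apply/and5P; split.
- by rewrite size_mkseq.
- apply/forallP => l; have lk : (l <= k)%N := ltn_ord l.
  by rewrite sE // /is_part /= /ht; apply/eqP; have := hc l lk; lia.
- by rewrite sE // (walk0 pc).
- apply/forallP => l; have lk := ltn_ord l; rewrite !sE //; last exact: ltnW.
  have ln : (l < n)%N by lia.
  have h1 := hc l (ltnW lk); have h2 := hc l.+1 lk.
  rewrite /arrow /= /ht; case: (walk_step pc ln) => e; rewrite e in h2 *.
    by apply/orP; left; apply/eqP; congr (_, _); lia.
  by apply/orP; right; apply/eqP; congr (_, _); lia.
- by rewrite sE.
Qed.

End TableauxAsWalks.

(** * F_t as the projection onto the walk of t *)

Section Projection.

Variables (n f : nat).
Local Notation E := (walk_module n f).

Definition acts_diag (y : TLF n) (g : walk -> Zx_frac) :=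
  forall psi c, is_walk n f c -> tlf_act E psi y c = g c * psi c.

Lemma acts_diag_prod (I : Type) (r : seq I) (P : pred I) (y : I -> TLF n) g :
  (forall i, P i -> acts_diag (y i) (g i)) ->
  acts_diag (\prod_(i <- r | P i) y i) (fun c => \prod_(i <- r | P i) g i c).
Proof.
move=> yg; elim: r => [|i r IH] psi c pc; first by rewrite !big_nil tlf_act1 mul1r.
rewrite !big_cons; case: ifP => Pi; last exact: IH.
by rewrite tlf_actM IH // yg // mulrCA mulrA.
Qed.

Lemma acts_diag_factor k (a r : Zx) : (k <= n)%N ->
  acts_diag ((a - r)%:F^-1 *: (tlF (T_elt n k) - r%:F%:A))
            (fun c => (a - r)%:F^-1 * (r_walk c k - r)%:F).
Proof.
move=> kn psi c pc; rewrite tlf_actZ tlf_actD tlf_actN tlf_act_tlF tlf_actZ tlf_act1.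
rewrite -mulrA -[LHS]/((a - r)%:F^-1 * (tl_act E psi (T_elt n k) c - r%:F * psi c)).
by rewrite act_T_elt // [(r_walk c k - r)%:F]tofracB mulrBl.
Qed.

Lemma mem_r_set c k : is_walk n f c -> (k <= n)%N -> r_walk c k \in r_set k.
Proof.
move=> pc kn; have [t tc] := walk_tab pc kn.
rewrite mem_undup; apply/flattenP.
exists [seq r_tab u k | u : tab k (c k, ht c k)].
  apply/mapP; exists (c k, ht c k) => //; rewrite mem_parts /is_part /= /ht.
  by apply/eqP; have := walk_half pc kn; lia.
apply/mapP; exists t; first by rewrite mem_enum.
by rewrite r_tabE; apply: eq_r_walk; rewrite tc //; lia.
Qed.

(** At the first difference the two walks leave the same point by opposite steps, and the values of
    r there differ by p_(h+1). The first step is always up, so k may start at 2. *)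
Lemma r_walk_inj c d : is_walk n f c -> is_walk n f d ->
  (forall k, (2 <= k <= n)%N -> r_walk c k = r_walk d k) -> c = d.
Proof.
move=> pc pd rE; apply/funext => k; have [kn|nk] := leqP k n; last first.
  by rewrite (walk_out pc nk) (walk_out pd nk).
elim: k kn => [|k IH] kn; first by rewrite (walk0 pc) (walk0 pd).
have {}IH := IH (ltnW kn); have [k0|kp] := posnP k.
  have := walk_half pc kn; have := walk_half pd kn; rewrite k0; lia.
have hE : ht c k = ht d k by rewrite /ht IH.
have := rE k.+1; rewrite ltnS kp kn => /(_ isT).
have ne a h : r_dn a h != r_up a h.
  by rewrite -subr_eq0 r_dnB_r_up -size_poly_eq0 size_p_pol.
case: (walk_step pc kn) (walk_step pd kn) => e1 [] e2.
- by rewrite e1 e2.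
- rewrite (r_walk_up pc kn e1) (r_walk_dn pd kn e2) IH hE => /esym/eqP.
  by rewrite (negbTE (ne _ _)).
- rewrite (r_walk_dn pc kn e1) (r_walk_up pd kn e2) IH hE => /eqP.
  by rewrite (negbTE (ne _ _)).
- by rewrite e1 e2 IH.
Qed.

Lemma tlf_act_F_tab (s : seq (nat * nat)) psi c :
  is_walk n f (tab_walk s) -> is_walk n f c ->
  tlf_act E psi (F_tab n s) c = if `[< c = tab_walk s >] then psi c else 0.
Proof.
move=> ps pc.
have D : acts_diag (F_tab n s) (fun d => \prod_(2 <= k < n.+1)
    \prod_(r <- r_set k | r != r_tab s k)
      ((r_tab s k - r)%:F^-1 * (r_walk d k - r)%:F)).
  rewrite /F_tab big_nat => phi d pd; rewrite [in RHS]big_nat.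
  move: phi d pd; apply: acts_diag_prod => k hk; apply: acts_diag_prod => r _.
  by apply: acts_diag_factor; lia.
rewrite D //; case: asboolP => [->|ne].
  rewrite big1 ?mul1r // => k _; rewrite big1 // => r.
  by rewrite r_tabE => rk; rewrite mulVf // tofrac_eq0 subr_eq0 eq_sym.
have [k hk rk] : exists2 k, (2 <= k <= n)%N & r_walk c k != r_walk (tab_walk s) k.
  apply: contra_notP ne => h; apply: (r_walk_inj pc ps) => k hk.
  by apply/eqP; apply: contra_notT h => nk; exists k.
rewrite (bigD1_seq k) ?iota_uniq ?mem_index_iota //=.
(* r_c(k) is one of the values over which the k-th inner product runs, and its factor vanishes at
   c. *)
have rm : r_walk c k \in [seq r <- r_set k | r != r_tab s k].
  by rewrite mem_filter r_tabE rk (mem_r_set pc) //; lia.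
rewrite -[X in X * _ * _]big_filter (bigD1_seq _ rm) ?filter_uniq ?undup_uniq //=.
by rewrite subrr tofrac0 mulr0 !mul0r.
Qed.

End Projection.

Lemma turns_agree n la k (s u : tab n la) : (0 < k < n)%N ->
  turns n la.1 k (tab_walk s) ->
  (forall j, j != k -> tab_walk u j = tab_walk s j) -> turns n la.1 k (tab_walk u).
Proof.
move=> kn /turnsP [_ e] su; apply/turnsP; split; first exact: is_walk_tab.
by rewrite !su //; lia.
Qed.

(** * Matrix coefficients of e_k *)

Section SeminormalForm.

Variables (n : nat) (la : nat * nat).
Hypothesis la_part : is_part n la.

Lemma exists_lift_f_tab : exists (C : Zx_frac)
    (L : cellF n la -> (walk -> Zx_frac^o)), [/\ C != 0,
  forall x k, (0 < k < n)%N ->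
    L (cellF_act x (tlF (tl_e n k))) = walk_gen n la.1 k (L x),
  forall (ek : tab n la -> Zx_frac) (x : tab n la -> cellF n la),
    L (\sum_s ek s *: x s) = \sum_s ek s *: L (x s) &
  forall (t : tab n la) c, is_walk n la.1 c ->
    L (f_tab t) c = if `[< c = tab_walk t >] then C * walk_weight n c else 0].
Proof.
have fn : (la.1.*2 <= n)%N by move: la_part => /eqP <-; exact: leq_addr.
pose E := walk_module n la.1.
have check0 v a : a \in check_ideal n la -> tl_act E v a = 0.
  exact: act_check_ideal.
exists ('X%:F ^+ la.1 / walk_weight n (low_walk n la.1)).
exists (cell_lift (la := la) E (low_vect n la.1)); split.
- rewrite mulf_neq0 ?expf_neq0 ?invr_eq0 ?tofrac_eq0 ?polyX_eq0 //.
  exact: walk_weight_neq0 (is_walk_low fn).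
- by move=> x k kn; rewrite (cell_lift_act _ check0) tlf_act_tlF tl_act_e.
- move=> ek x; rewrite (cell_lift_sum _ check0); apply: eq_bigr => s _.
  exact: (cell_liftZ _ check0).
move=> t c pc; have pt := is_walk_tab t.
rewrite /f_tab (cell_lift_act _ check0) (cell_lift_m_tab _ check0) tl_actM.
rewrite tlf_act_F_tab //; case: asboolP => // ->.
have := leads_low (erefl la.1) fn; rewrite -(low_below_end pt).
by case/(leads_v_elt pt (leqnn n) (fun l _ => erefl)).
Qed.

Variables (k : nat) (ek : tab n la -> tab n la -> Zx_frac).
Hypothesis kn : (0 < k < n)%N.
Hypothesis ek_def : forall u : tab n la,
  cellF_act (f_tab u) (tlF (tl_e n k)) = \sum_(s : tab n la) ek s u *: f_tab s.

(** Applying the lift to [ek_def] and evaluating at the walk of s leaves the single summand f_s; the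
    constant C then cancels. *)
Lemma ek_weight (s u : tab n la) :
  ek s u * walk_weight n (tab_walk s) =
  walk_gen n la.1 k
    (fun c => if `[< c = tab_walk u >] then walk_weight n c else 0) (tab_walk s).
Proof.
have [C [L [C0 Lact Lsum Lf]]] := exists_lift_f_tab.
have ps := is_walk_tab s; apply: (mulfI C0).
have <- : L (cellF_act (f_tab u) (tlF (tl_e n k))) (tab_walk s) =
    C * (ek s u * walk_weight n (tab_walk s)).
  rewrite ek_def Lsum fct_sumE (bigD1 s) //= big1 => [|v vs].
    rewrite addr0 -[LHS]/(ek s u * L (f_tab s) (tab_walk s)) Lf // asboolT //.
    exact: mulrCA.
  rewrite -[LHS]/(ek v u * L (f_tab v) (tab_walk s)) Lf //.
  by case: asboolP => [/tab_walk_inj sv|]; [rewrite sv eqxx in vs | rewrite mulr0].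
rewrite Lact // /walk_gen; case: ifP => [ts|]; last by rewrite mulr0.
have [t1 t2] := turns_upd kn ts.
have lift_if c : is_walk n la.1 c -> L (f_tab u) c =
    C * (if `[< c = tab_walk u >] then walk_weight n c else 0).
  by move=> pc; rewrite Lf //; case: ifP; rewrite ?mulr0.
case/turnsP: t1 => p1 _; rewrite (lift_if _ p1) mulrDr !(mulrCA C).
(* Over height 0 the second modification is not a walk, so [lift_if] says nothing there, but its
   coefficient is 0. *)
congr (_ + _); have [h0|hp] := posnP (ht (tab_walk s) k.-1).
  by rewrite h0 w_dn0 !mul0r.
by case/turnsP: (t2 hp) => p2 _; rewrite (lift_if _ p2).
Qed.

Lemma ek_neq0 (s u : tab n la) : ek s u != 0 ->
  turns n la.1 k (tab_walk s) /\
  (forall j, j != k -> tab_walk u j = tab_walk s j).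
Proof.
move=> nz; have nzw : ek s u * walk_weight n (tab_walk s) != 0.
  by apply: mulf_neq0 nz (walk_weight_neq0 (is_walk_tab s)).
move: nzw; rewrite ek_weight => /(walk_gen_neq0 kn) [ts [v [_]]].
case: asboolP; rewrite ?eqxx // => e _; split=> // j jk.
by rewrite -e upd_neq.
Qed.

Lemma ekE (s u : tab n la) : turns n la.1 k (tab_walk s) ->
  (forall j, j != k -> tab_walk u j = tab_walk s j) ->
  ek s u = (if tab_walk u k == tab_walk u k.-1 then w_up (ht (tab_walk u) k.-1)
            else w_dn (ht (tab_walk u) k.-1)) *
           (walk_weight n (tab_walk u) / walk_weight n (tab_walk s)).
Proof.
move=> ts su; have ws0 := walk_weight_neq0 (is_walk_tab s).
apply: (mulIf ws0); rewrite ek_weight -mulrA divfK // /walk_gen ts.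
have km : k.-1 != k by lia.
have uE v : tab_walk u k = v -> upd (tab_walk s) k v = tab_walk u.
  by move=> <-; apply/funext => j; rewrite /upd; case: eqP => [->|/eqP/su].
have nE v : tab_walk u k <> v -> upd (tab_walk s) k v <> tab_walk u.
  by move=> nv e; apply: nv; rewrite -e updE.
rewrite (su _ km) (_ : ht (tab_walk u) k.-1 = ht (tab_walk s) k.-1); last first.
  by rewrite /ht su.
have [e|ne] := eqVneq (tab_walk u k) (tab_walk s k.-1).
  rewrite (uE _ e) (asboolT (erefl (tab_walk u))) asboolF ?mulr0 ?addr0 //.
  by apply: nE; rewrite e; lia.
have kn1 : (k.-1 < n)%N by lia.
have ek1 : k.-1.+1 = k by lia.
have e : tab_walk u k = (tab_walk s k.-1).+1.
  case: (walk_step (is_walk_tab u) kn1); rewrite ek1 (su _ km) => // e.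
  by rewrite e eqxx in ne.
rewrite (uE _ e) (asboolT (erefl (tab_walk u))) asboolF ?mulr0 ?add0r //.
by apply: nE; rewrite e; lia.
Qed.

End SeminormalForm.

Theorem lemma4p5 (n : nat) (la : nat * nat) (t : tab n la) (k : nat)
    (ek : tab n la -> tab n la -> Zx_frac)
    (la_part : is_part n la)
    (k_bounds : (1 <= k < n)%N)
    (ek_def : forall u : tab n la,
      cellF_act (f_tab u) (tlF (tl_e n k)) =
        \sum_(s : tab n la) ek s u *: f_tab s) :
  [/\ forall s : tab n la, ek s t != 0 ->
        forall i : nat, (i <= n)%N -> i != k -> i != k.+1 ->
          r_tab s i = r_tab t i,
      forall s : tab n la, ek s t != 0 ->
        yd_row t k.-1 = yd_row t k.+1 /\ yd_row s k.-1 = yd_row s k.+1,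
      forall s : tab n la, ek s t != 0 -> s != t ->
        forall u : tab n la, u \notin [:: s; t] -> ek u t = 0
    & forall s : tab n la, ek s t != 0 -> tab_sdom t s ->
        [/\ ek t t = (r_tab t k.+1 + z_tab t k.-1)%:F
                     / (p_pol k - 'X * z_tab t k.-1 - r_tab t k *+ 2)%:F,
            ek s t = 1,
            ek s s = (r_tab s k.+1 + z_tab s k.-1)%:F
                     / (p_pol k - 'X * z_tab s k.-1 - r_tab s k *+ 2)%:F
          & ek t s = ek s s * ek t t]].
Proof.
have agree := ek_neq0 la_part k_bounds ek_def.
have coefE := ekE la_part k_bounds ek_def.
have kS : k.-1.+1 = k by lia.
have km : k.-1 != k by lia.
have kp : k.+1 != k by lia.
have k1n : (k.-1 < n)%N by lia.
have at_k (u s : tab n la) : ek u s != 0 ->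
    tab_walk s k = tab_walk u k.-1 \/ tab_walk s k = (tab_walk u k.-1).+1.
  move=> /agree [_ us]; have := walk_step (is_walk_tab s) k1n.
  by rewrite kS (us _ km).
have eq_tab (s u : tab n la) : (forall j, j != k -> tab_walk u j = tab_walk s j) ->
    tab_walk u k = tab_walk s k -> u = s.
  move=> us ek'; apply: tab_walk_inj; apply/funext => j.
  by have [->|/us] := eqVneq j k.
have self (s : tab n la) : forall j, j != k -> tab_walk s j = tab_walk s j by [].
have own_step (u : tab n la) : turns n la.1 k (tab_walk u) ->
    tab_walk u k = tab_walk u k.-1 \/ tab_walk u k = (tab_walk u k.-1).+1.
  by move=> /turnsP [pu _]; have := walk_step pu k1n; rewrite kS.
split.
(* r(i) depends only on the coordinates at i.-1 and i, and neither place is k. *)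
- move=> s /agree [_ st] i _ ik ikS; rewrite !r_tabE; apply: eq_r_walk.
    by rewrite st //; move: k_bounds; lia.
  by rewrite st.
- move=> s /agree [ts st]; have tt := turns_agree k_bounds ts st.
  have row (u : tab n la) : turns n la.1 k (tab_walk u) ->
      yd_row u k.-1 = yd_row u k.+1.
    move=> /turnsP [_ e]; rewrite /yd_row !shape_tab //=; try lia.
    by rewrite /ht e; lia.
  by split; exact: row.
- move=> s st0 nst u; rewrite !inE negb_or => /andP [nus nut].
  apply/eqP; apply: contraT => ut0.
  have [ts st] := agree _ _ st0; have [tu ut] := agree _ _ ut0.
  have us j : j != k -> tab_walk u j = tab_walk s j.
    by move=> jk; rewrite -(ut _ jk) -(st _ jk).
  have nk1 : tab_walk s k != tab_walk t k.
    by apply: contra nst => /eqP e; apply/eqP/esym/eq_tab.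
  have nk2 : tab_walk u k != tab_walk t k.
    by apply: contra nut => /eqP e; apply/eqP/esym/eq_tab.
  (* The three tableaux agree off k, where only two values are possible. *)
  have nk3 : tab_walk u k != tab_walk s k.
    by apply: contra nus => /eqP e; apply/eqP/eq_tab.
  have := own_step _ ts; have := own_step _ tu; have := at_k _ _ st0.
  by rewrite (us _ km); lia.
move=> s st0 /andP [dom nts].
have [ts st] := agree _ _ st0; have tt := turns_agree k_bounds ts st.
have ts' j : j != k -> tab_walk s j = tab_walk t j by move=> /st ->.
have le : (tab_walk s k <= tab_walk t k)%N.
  have k_ord : (k < n.+1)%N by lia.
  have := forallP dom (Ordinal k_ord) => /=.
  by case/andP: k_bounds => -> _; exact.
(* Dominance means a larger coordinate, hence a smaller height: s has the peak at k and t the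
   valley. *)
have sk : tab_walk s k = tab_walk s k.-1.
  case: (own_step _ ts) => // e; case/eqP: nts; apply: (eq_tab _ _ st).
  by have := own_step _ tt; rewrite (st _ km); lia.
have tk : tab_walk t k = (tab_walk t k.-1).+1.
  case: (own_step _ tt) => // e; case/eqP: nts; apply: (eq_tab _ _ st).
  by rewrite e sk (st _ km).
have wt0 := walk_weight_neq0 (is_walk_tab t).
have ws0 := walk_weight_neq0 (is_walk_tab s).
have h0 := turn_valley_ht k_bounds tt tk.
have hE : ht (tab_walk t) k.-1 = ht (tab_walk s) k.-1 by rewrite /ht (st _ km).
have sE : tab_walk s = upd (tab_walk t) k (tab_walk t k.-1).
  apply/funext => j; rewrite /upd; case: eqP => [->|/eqP /ts' //].
  by rewrite sk (st _ km).
have wE : walk_weight n (tab_walk s) =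
    w_dn (ht (tab_walk t) k.-1) * walk_weight n (tab_walk t).
  rewrite sE; case/turnsP: tt => pt e; exact: (walk_weight_flip k_bounds pt).
have tk' : (tab_walk t k == tab_walk t k.-1) = false by apply/eqP; lia.
have wd0 : w_dn (ht (tab_walk t) k.-1) != 0.
  by apply: contra ws0 => /eqP e; rewrite wE e mul0r.
have ttE : ek t t = w_dn (ht (tab_walk t) k.-1).
  by rewrite (coefE _ _ tt (self t)) tk' (divff wt0) mulr1.
have ssE : ek s s = w_up (ht (tab_walk s) k.-1).
  by rewrite (coefE _ _ ts (self s)) sk eqxx (divff ws0) mulr1.
split.
- by rewrite ttE; exact: w_dn_turn k_bounds tt tk.
(* The coefficient [w_dn] cancels against the ratio of weights given by [wE]. *)
- rewrite (coefE _ _ ts st) tk' -[RHS](divff ws0) [X in _ = X / _]wE.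
  exact: mulrA.
- by rewrite ssE; exact: w_up_turn k_bounds ts sk.
- rewrite ssE ttE (coefE _ _ tt ts') sk eqxx.
  by rewrite wE (mulfK wt0).
Qed.
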